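(* Let $(u,w)$ be a pair of weights on $\mathbb{R}$ and let $t\le 0$ or $t\ge 1$. Then the $t$-Haar multipliers $T^t_{w,\sigma}$ are uniformly (on the choice of signs $\sigma$) bounded from $L^2(u)$ into itself if and only if the following three conditions hold. (i) Joint two-weight condition: $$C_1:=\sup_{I\in\mathcal{D}} \frac{\langle u^{-1}\rangle_I\, \langle u w^{2t}\rangle_I}{\langle w\rangle_I^{2t}} <\infty .$$ (ii) Carleson condition ($u^{-1}$-Carleson sequence): there is $C_2>0$ such that for all $I\in\mathcal{D}$, $$\frac{1}{|I|} \sum_{J\in\mathcal{D}:\, J\subset I} |J|\,|\Delta_J u^{-1}|^2\, \frac{\langle uw^{2t}\rangle_J}{\langle w\rangle_J^{2t}}\leq C_2\, \langle u^{-1}\rangle_I .$$ (iii) Dual Carleson condition ($uw^{2t}$-Carleson sequence): there is $C_3>0$ such that for all $I\in\mathcal{D}$, $$\frac{1}{|I|} \sum_{J\in\mathcal{D}:\, J\subset I} |J|\,|\Delta_J (uw^{2t})|^2\, \frac{\langle u^{-1}\rangle_J}{\langle w\rangle_J^{2t}}\leq C_3\, \langle uw^{2t} \rangle_I .$$ Moreover, $$\|T^t_{w,\sigma}\|_{L^2(u)\to L^2(u)} \approx \sqrt{C_1} + \sqrt{C_2} + \sqrt{C_3} + \sqrt{C_2C_3}.$$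
   Context: A weight is an almost everywhere positive, locally integrable function on $\mathbb{R}$; $L^2(u)$ is the space of functions $f$ with $\|f\|_{L^2(u)}^2=\int_{\mathbb{R}}|f(x)|^2u(x)\,dx<\infty$. $\mathcal{D}$ is the set of standard dyadic intervals $[2^{-j}k,2^{-j}(k+1))$, $j,k\in\mathbb{Z}$. For $I\in\mathcal{D}$, $I_+$ and $I_-$ are its right and left halves, $|I|$ is its length, $\mathbf{1}_I$ its characteristic function, $\langle f\rangle_I=\frac{1}{|I|}\int_I f(x)\,dx$, and $\Delta_I f=\langle f\rangle_{I_+}-\langle f\rangle_{I_-}$. The Haar function is $h_I=|I|^{-1/2}(\mathbf{1}_{I_+}-\mathbf{1}_{I_-})$, and $\langle f,g\rangle$ is the $L^2(\mathbb{R})$ inner product. A choice of signs is $\sigma=\{\sigma_I\}_{I\in\mathcal{D}}$ with $\sigma_I=\pm1$. The $t$-Haar multiplier, acting on locally integrable functions $f$, is defined formally by $$T^t_{w,\sigma} f(x) = \sum_{I\in \mathcal{D}} \sigma_I\left (\frac{w(x)}{\langle w\rangle_I}\right )^t \langle f,h_I\rangle \,h_I(x).$$ For a weight $\nu$, a sequence of positive numbers $\{\lambda_J\}_{J\in\mathcal{D}}$ is a $\nu$-Carleson sequence if there is $C>0$ with $\sum_{J\in\mathcal{D}:\,J\subset I}\lambda_J\le C\int_I\nu\,dx$ for all $I\in\mathcal{D}$. $A\lesssim B$ means that there is a constant $C>0$ such that $A\le CB$, and $A\approx B$ means $A\lesssim B$ and $B\lesssim A$.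
   Formalization: A lower norm bound with a weight-independent constant is false (w=1, u=|x|^a, a→1; or fixed signs); here its constant may depend on (u,w) and t, not on σ. The upper bound, and √C1+√C2+√C3 ≲ sup over σ of the norm, hold with an absolute constant. *)

(* Defs.v *)
(* MathComp-Analysis *)
From HB Require Import structures.
From mathcomp Require Import all_boot all_order all_algebra finmap.
From mathcomp Require Import all_classical all_reals all_analysis.
From mathcomp.analysis Require Import showcase.summability.
Set Implicit Arguments.
Unset Strict Implicit.
Unset Printing Implicit Defensive.
Import Order.TTheory GRing.Theory Num.Theory.
Import numFieldNormedType.Exports.
Local Open Scope classical_set_scope.
Local Open Scope ring_scope.

(* The pair (j, k) stands for the interval [2^-j k, 2^-j (k+1)); distinct pairs
   give distinct intervals, so int * int indexes the dyadic intervals exactly. *)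
Notation dyadic := (int * int)%type.

Definition dlen {R : realType} (I : dyadic) : R := 2 ^ (- I.1).

Definition ditv {R : realType} (I : dyadic) : set R :=
  [set` `[dlen I * I.2%:~R, dlen I * (I.2 + 1)%:~R[].

Definition dleft (I : dyadic) : dyadic := (I.1 + 1, 2 * I.2).
Definition dright (I : dyadic) : dyadic := (I.1 + 1, 2 * I.2 + 1).

Section definitions.
Context {R : realType}.
Local Notation mu := (@lebesgue_measure R).
Implicit Types (f g u v w nu : R -> R) (t C : R) (I J : dyadic).
Implicit Types (s : dyadic -> bool) (F : {fset dyadic}).

Definition weight w :=
  locally_integrable setT w /\ {ae mu, forall x, 0 < w x}.

(* Averages are extended reals: u^-1 and u w^(2t) need not be locally
   integrable, in which case some of their averages are +oo. *)
Definition avg f I : \bar R :=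
  ((dlen I)^-1%:E * \int[mu]_(x in ditv I) (f x)%:E)%E.

Definition delta f I : \bar R := (avg f (dright I) - avg f (dleft I))%E.

Definition haar I : R -> R := fun x =>
  (Num.sqrt (dlen I))^-1 *
  (\1_(ditv (dright I)) x - \1_(ditv (dleft I)) x).

Definition haar_coef f I : R := \int[mu]_x (f x * haar I x).

Definition L2norm u f : \bar R :=
  sqrte (\int[mu]_x (`|f x| ^+ 2 * u x)%:E)%E.

Definition inL2 u f := measurable_fun setT f /\ (L2norm u f < +oo)%E.

(* The signs are sigma_I = (-1) ^+ s I. *)
Definition tHaar_sum w t s f F : R -> R := fun x =>
  \sum_(I <- F)
    (-1) ^+ s I * (w x / fine (avg w I)) `^ t * haar_coef f I * haar I x.

(* g is T^t_{w,sigma} f: the formal series over the (unordered) set of dyadic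
   intervals converges unconditionally to g in L^2(u), i.e. along the net of
   its finite partial sums. *)
Definition tHaar_image u w t s f g :=
  inL2 u g /\
  L2norm u (fun x => tHaar_sum w t s f F x - g x) @[F --> totally] --> 0%E.

(* The multiplier acts on locally integrable functions, and L^2(u) consists of
   such functions only when u^-1 is locally integrable, which is not assumed:
   hence the restriction on f. *)
Definition tHaar_bounded_by u w t s C := forall f,
  inL2 u f -> locally_integrable setT f ->
  exists2 g, tHaar_image u w t s f g & (L2norm u g <= C%:E * L2norm u f)%E.

Definition tHaar_unif_bounded u w t :=
  exists2 C, 0 <= C & forall s, tHaar_bounded_by u w t s C.

Definition tHaar_norm u w t s : \bar R :=
  ereal_inf [set C%:E | C in [set C | 0 <= C /\ tHaar_bounded_by u w t s C]].

Definition inv_weight u : R -> R := fun x => (u x)^-1.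
Definition mul_weight u w t : R -> R := fun x => u x * w x `^ (2 * t).

Definition joint_const u w t : \bar R :=
  ereal_sup [set avg (inv_weight u) I * avg (mul_weight u w t) I *
                 ((fine (avg w I) `^ (2 * t))^-1)%:E | I in setT]%E.

(* With (nu, v) = (u^-1, u w^(2t)) this is the Carleson condition with constant
   C, and with (nu, v) = (u w^(2t), u^-1) the dual one. *)
Definition carleson_bound nu v w t C := forall I,
  ((dlen I)^-1%:E *
   (\esum_(J in [set J | @ditv R J `<=` ditv I])
      ((dlen J)%:E * `|delta nu J| ^+ 2 *
       (avg v J * ((fine (avg w J) `^ (2 * t))^-1)%:E)))
   <= C%:E * avg nu I)%E.

Definition carleson_const nu v w t : \bar R :=
  ereal_inf [set C%:E | C in [set C | 0 < C /\ carleson_bound nu v w t C]].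

End definitions.

(* Main.v *)
Require Import Defs.
From HB Require Import structures.
From mathcomp Require Import all_boot all_order all_algebra finmap.
From mathcomp Require Import all_classical all_reals all_analysis.
From mathcomp.analysis Require Import showcase.summability.
From mathcomp Require Import measurable_realfun.
From mathcomp Require Import ring lra zify.
Set Implicit Arguments.
Unset Strict Implicit.
Unset Printing Implicit Defensive.
Import Order.TTheory GRing.Theory Num.Theory.
Import numFieldNormedType.Exports.
Local Open Scope classical_set_scope.
Local Open Scope ring_scope.

(** Write nu = u^-1 and v = u w^(2t).  On the points where w is positive, the
    multiplier is w^t times the Haar sum with coefficients
    r_I sigma_I <f, h_I>, where r_I = <w>_I^-t, so its norm on L^2(u) is the
    norm of f |-> sum_I sigma_I r_I <f, h_I> h_I from L^2(u) to L^2(v).  All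
    quantities ignore null sets, hence u and w may be taken positive
    everywhere.

    Sufficiency.  Testing a finite Haar sum on itself leads to
    sum_I r_I |<f, h_I>| |<g v, h_I>|.  With m = int nu, x = int f and
    X = int f^2 u, all additive on the dyadic tree, the increment of x across
    the halves of I is its component along the Haar function adapted to nu
    plus (x_I / m_I) times the increment of m; likewise for g v and v.  The
    product has four terms.  The adapted components are square summable by
    telescoping (bessel_sum_le), and the average terms by the Carleson
    embedding theorem (carleson_embedding), so that the Cauchy-Schwarz
    inequality gives sqrt C1, sqrt C2, sqrt C3 and sqrt (C2 C3).  In the last
    term the weights r_I do not match those of the two Carleson sequences; the
    mismatch is harmless because <nu>_I <v>_I >= <w>_I^(2t), a consequence of
    Jensen's inequality which is where t <= 0 or t >= 1 enters (joint_ge1).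
    The bound of a partial sum is in terms of summable quantities attached to
    its intervals, so the net of partial sums is Cauchy, and a Riesz-Fischer
    argument (energy_complete) provides the image of f.

    Necessity.  Averaging two choices of signs bounds all the partial sums
    (partial_sum_bound), and a choice of signs for which a finite sum has at
    least the energy of its separate terms (exists_signs) then bounds
    sum_I r_I^2 <f, h_I>^2 <v>_I by a multiple of the squared norm of f.  The
    test functions u^-1 h_I (truncated) and u^-1 1_I yield the joint and the
    Carleson condition; the dual Carleson condition is the same test for the
    adjoint.  Finally the image of h_I has a norm which does not depend on the
    signs, so that no individual multiplier is small. *)

(** * Finite trees of dyadic intervals *)

Fixpoint subtree (n : nat) (I : dyadic) : seq dyadic :=
  if n is n'.+1 then I :: subtree n' (dleft I) ++ subtree n' (dright I)
  else [::].

Lemma mem_subtree n (I J : dyadic) : J \in subtree n I <->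
  exists d : nat, [/\ (d < n)%N, J.1 = I.1 + d%:Z,
    (2 ^ d)%N%:Z * I.2 <= J.2 & J.2 < (2 ^ d)%N%:Z * (I.2 + 1)].
Proof.
elim: n I => [|n IHn] I /=; first by split=> // -[d []].
rewrite inE mem_cat; split.
  case/or3P => [/eqP ->|/IHn[d [dn e1 e2 e3]]|/IHn[d [dn e1 e2 e3]]].
  - by exists 0%N; rewrite expn0; split => //; lia.
  - exists d.+1; rewrite expnS; move: e1 e2 e3 => /=; split; [lia|lia|lia|].
    have : (0 < 2 ^ d)%N by rewrite expn_gt0.
    lia.
  - exists d.+1; rewrite expnS; move: e1 e2 e3 => /=; split; [lia|lia| |].
      have : (0 < 2 ^ d)%N by rewrite expn_gt0.
      lia.
    lia.
case=> -[|d] [dn e1 e2 e3].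
  move: e1 e2 e3; case: (I) (J) => [i k] [j l] /=; rewrite expn0 => e1 e2 e3.
  by apply/or3P/Or31/eqP; congr pair; lia.
have d0 : (0 < 2 ^ d)%N by rewrite expn_gt0.
rewrite expnS in e2 e3.
have [lt|ge] := ltP J.2 ((2 ^ d)%N%:Z * (2 * I.2 + 1)).
  by apply/or3P/Or32/IHn; exists d; split => /=; lia.
by apply/or3P/Or33/IHn; exists d; split => /=; lia.
Qed.

Lemma subtree_uniq n I : uniq (subtree n I).
Proof.
elim: n I => //= n IHn I; rewrite cat_uniq !IHn mem_cat negb_or andbT /=.
apply/andP; split.
  by apply/andP; split; apply/negP => /mem_subtree [d [_ /= h _ _]]; lia.
apply/hasPn => J /mem_subtree [d [_ /= e1 e2 _]].
apply/negP => /mem_subtree [d' [_ /= e1' _ e3]].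
have dd : d = d' by lia.
subst d'; lia.
Qed.

(** No dyadic interval has points on both sides of the origin, so two trees are
    needed, rooted at [0, 2^N) and [-2^N, 0); one N serves the whole family. *)
Lemma subtree_cover (s : seq dyadic) : exists n N : nat,
  {subset s <= subtree n (- N%:Z, 0) ++ subtree n (- N%:Z, - 1)}.
Proof.
pose size_of (J : dyadic) := (absz J.1 + absz J.2 + 1)%N.
pose N := (\sum_(J <- s) size_of J)%N.
exists (2 * N + 1)%N, N => -[j l] Js.
have : (size_of (j, l) <= N)%N by rewrite /N (big_rem (j, l)) //= leq_addr.
rewrite /size_of /=; move: N => N szJ.
pose d := absz (j + N%:Z).
have dE : d%:Z = j + N%:Z by rewrite /d; lia.
have dJ : (absz l < 2 ^ d)%N.
  by apply: (leq_ltn_trans _ (ltn_expl d (isT : (1 < 2)%N))); lia.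
rewrite mem_cat; apply/orP; have [l0|g0] := ltP l 0; [right|left];
  apply/mem_subtree; exists d; split => /=; lia.
Qed.

Lemma ler_sum_uniq_sub (R : numDomainType) (T : eqType) (s s' : seq T)
    (p : T -> R) : uniq s -> uniq s' -> {subset s <= s'} ->
  (forall x, 0 <= p x) -> \sum_(x <- s) p x <= \sum_(x <- s') p x.
Proof.
move=> us us' ss' p0.
rewrite (bigID (fun x => x \in s) xpredT p (r := s')) /= -[leLHS]addr0 lerD ?sumr_ge0//.
  rewrite -[in leRHS]big_filter (perm_big [seq x <- s' | x \in s])//.
  apply: uniq_perm => //; first exact: filter_uniq.
  by move=> x; rewrite mem_filter; case: (boolP (x \in s)) => //= /ss' ->.
Qed.

Section bellman.
Context {R : realType}.
Implicit Types (p m n x y rho lam X : dyadic -> R) (I J : dyadic).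

Definition tree_additive x := forall I, x I = x (dleft I) + x (dright I).

(** The Bellman function method: an inequality relating B at an interval to B at
    its two halves is summed over the tree. *)
Lemma bellman_sum_le p (B : nat -> dyadic -> R) :
  (forall I, 0 <= B 0%N I) ->
  (forall k I, p I + (B k (dleft I) + B k (dright I)) <= B k.+1 I) ->
  forall k I, \sum_(J <- subtree k I) p J <= B k I.
Proof.
move=> B0 BS; elim=> [|k IHk] I /=; first by rewrite big_nil.
rewrite big_cons big_cat /=; apply: le_trans (BS k I).
by rewrite lerD2l lerD.
Qed.

Lemma sum_halflines_le p X (c Xtot : R) :
  (forall J, 0 <= p J) -> (forall k I, \sum_(J <- subtree k I) p J <= c * X I) ->
  0 <= c -> (forall N : nat, X (- N%:Z, 0) + X (- N%:Z, - 1) <= Xtot) ->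
  forall F : {fset dyadic}, \sum_(J <- F) p J <= c * Xtot.
Proof.
move=> p0 ptree c0 Xle F.
have [k [N FkN]] := subtree_cover F.
apply: (@le_trans _ _ (\sum_(J <- subtree k (- N%:Z, 0) ++ subtree k (- N%:Z, - 1)) p J)).
  apply: ler_sum_uniq_sub => //.
  by rewrite cat_uniq !subtree_uniq andbT /=; apply/hasPn => J
       /mem_subtree[d [_ e1 _ e3]]; apply/negP => /mem_subtree[d' [_ e1' e2 _]];
       move: e1 e3 e1' e2 => /=; lia.
rewrite big_cat /=; apply: (@le_trans _ _ (c * X (- N%:Z, 0) + c * X (- N%:Z, - 1))).
  by rewrite lerD.
by rewrite -mulrDr ler_wpM2l.
Qed.
End bellman.

(** * Bessel, Carleson and the bilinear sum on a tree *)

(** Young's inequality for every weight s is the Cauchy-Schwarz inequality. *)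
Lemma sqr_le_mul_quad (R : realFieldType) (a b c : R) :
  (forall s : R, 0 < s -> 2 * b <= s * a + s^-1 * c) ->
  0 <= a -> 0 <= c -> 0 <= b -> b ^+ 2 <= a * c.
Proof.
move=> H a0 c0 b0.
have [->|bn0] := eqVneq b 0; first by rewrite expr0n mulr_ge0.
have bp : 0 < b by rewrite lt_neqAle eq_sym bn0.
have [a00|an0] := eqVneq a 0.
  have sp : 0 < (c + b) / b by rewrite divr_gt0 // ltr_wpDl.
  have := H _ sp; rewrite a00 mulr0 add0r invf_div => h.
  have h2 : 2 * b * (c + b) <= b * c.
    have := ler_wpM2r (addr_ge0 c0 b0) h.
    by rewrite [X in _ <= X](_ : _ = b * c)//; field; lra.
  exfalso; nra.
have ap : 0 < a by rewrite lt_neqAle eq_sym an0.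
have := H (b / a) (divr_gt0 bp ap).
rewrite invf_div mulfVK // => h.
have : b <= a / b * c by lra.
move/(ler_wpM2l b0); rewrite [X in _ <= X](_ : _ = a * c) -?expr2 //.
by field.
Qed.

Lemma sum_sqrt_CS (R : rcfType) (T : Type) (s : seq T) (p q : T -> R) :
  (forall x, 0 <= p x) -> (forall x, 0 <= q x) ->
  \sum_(x <- s) Num.sqrt (p x) * Num.sqrt (q x) <=
  Num.sqrt (\sum_(x <- s) p x) * Num.sqrt (\sum_(x <- s) q x) :> R.
Proof.
move=> p0 q0.
have A0 : 0 <= \sum_(x <- s) p x by rewrite sumr_ge0.
have B0 : 0 <= \sum_(x <- s) q x by rewrite sumr_ge0.
have S0 : 0 <= \sum_(x <- s) Num.sqrt (p x) * Num.sqrt (q x).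
  by rewrite sumr_ge0 // => x _; rewrite mulr_ge0 ?sqrtr_ge0.
rewrite -sqrtrM // -[leLHS](ger0_norm S0) -sqrtr_sqr ler_wsqrtr //.
apply: sqr_le_mul_quad => // e e0.
rewrite !mulr_sumr -big_split /=; apply: ler_sum => x _.
have e'0 : 0 < e^-1 by rewrite invr_gt0.
rewrite -{2}(sqr_sqrtr (p0 x)) -{2}(sqr_sqrtr (q0 x)).
set a := Num.sqrt _; set b := Num.sqrt _.
rewrite -subr_ge0 (_ : _ - _ = e * (a - e^-1 * b) ^+ 2).
  by rewrite mulr_ge0 ?sqr_ge0 // ltW.
by field; lra.
Qed.

Section tree_estimates.
Context {R : realType}.
Implicit Types (p m n x y rho lam X : dyadic -> R) (I J : dyadic).

(** The squared component of x along the Haar function of I adapted to the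
    measure m: the part of x_I^2 / m_I gained by splitting I. *)
Definition bessel m x I :=
  x (dleft I) ^+ 2 / m (dleft I) + x (dright I) ^+ 2 / m (dright I)
  - x I ^+ 2 / m I.

(** If m and n are the integrals of nu and v, and rho I = <w>_I^-t / |I|, this is
    the term |I| |Delta_I nu|^2 <v>_I / <w>_I^(2t) of the Carleson condition;
    with rho the lengths of the intervals disappear. *)
Definition carleson_term m n rho I :=
  4 * rho I ^+ 2 * n I * (m (dright I) - m (dleft I)) ^+ 2.

Lemma convex_ratio (a b M N : R) : 0 < M -> 0 < N ->
  (a + b) ^+ 2 / (M + N) <= a ^+ 2 / M + b ^+ 2 / N.
Proof.
move=> M0 N0; rewrite -subr_ge0.
rewrite (_ : _ - _ = (a * N - b * M) ^+ 2 / (M * N * (M + N))).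
  by rewrite divr_ge0 ?sqr_ge0 // !mulr_ge0 ?addr_ge0 // ltW.
by field; rewrite !lt0r_neq0 ?addr_gt0.
Qed.

Lemma bessel_ge0 m x I : tree_additive m -> tree_additive x ->
  (forall J, 0 < m J) -> 0 <= bessel m x I.
Proof.
by move=> mA xA m0; rewrite /bessel subr_ge0 (xA I) (mA I) convex_ratio.
Qed.

(** Each term is the growth of the sum of the x^2 / m when one interval is
    split, and this sum never exceeds X. *)
Lemma bessel_sum_le m x X : tree_additive m -> tree_additive x ->
  tree_additive X -> (forall J, 0 < m J) -> (forall J, x J ^+ 2 / m J <= X J) ->
  forall k I, \sum_(J <- subtree k I) bessel m x J <= 1 * X I :> R.
Proof.
move=> mA xA XA m0 xX k I; rewrite mul1r.
have le1 : X I - x I ^+ 2 / m I <= X I.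
  by rewrite gerDl oppr_le0 divr_ge0 ?sqr_ge0 // ltW.
apply: (le_trans _ le1).
apply: (bellman_sum_le (B := fun _ I => X I - x I ^+ 2 / m I)) => [J|_ J].
  by rewrite subr_ge0.
by rewrite /bessel (XA J); lra.
Qed.

(** The weighted Carleson embedding theorem, by the Bellman function
    X - x^2 / (m + A), where A is the sum of the lam / C accumulated so far: it
    is superadditive in all variables, and increasing A by a gains at least
    a x^2 / (4 m^2), because A never exceeds m. *)
Lemma carleson_embedding m x X lam (C : R) : tree_additive m ->
  tree_additive x -> tree_additive X -> (forall J, 0 < m J) ->
  (forall J, x J ^+ 2 / m J <= X J) ->
  (forall J, 0 <= lam J) -> 0 <= C ->
  (forall k I, \sum_(J <- subtree k I) lam J <= C * m I :> R) ->
  forall k I, \sum_(J <- subtree k I) lam J * (x J / m J) ^+ 2 <= 4 * C * X I :> R.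
Proof.
move=> mA xA XA m0 xX lam0; rewrite le_eqVlt => /predU1P[<- lamC k I|C0 lamC].
  rewrite mulr0 mul0r big1 // => J _.
  have /eqP : lam J == 0.
    rewrite eq_le lam0 andbT.
    by have := lamC 1%N J; rewrite /= big_seq1 mul0r.
  by move->; rewrite mul0r.
pose A k I := (\sum_(J <- subtree k I) lam J) / C.
have A0 k I : 0 <= A k I by rewrite divr_ge0 ?sumr_ge0 // ltW.
have Am k I : A k I <= m I by rewrite ler_pdivrMr // mulrC.
have Mp k I : 0 < m I + A k I by rewrite ltr_wpDr.
pose B k I := 4 * C * (X I - x I ^+ 2 / (m I + A k I)).
move=> k I; have le1 : B k I <= 4 * C * X I.
  apply: ler_wpM2l; first by rewrite mulr_ge0 // ltW.
  by rewrite gerDl oppr_le0 divr_ge0 ?sqr_ge0 // ltW.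
apply: (le_trans _ le1); apply: (bellman_sum_le (B := B)) => {k I le1} [I|k I].
  rewrite /B /A /= big_nil mul0r addr0.
  by rewrite !mulr_ge0 ?subr_ge0 // ltW.
pose M := m I + (A k (dleft I) + A k (dright I)).
have ME : M = (m (dleft I) + A k (dleft I)) + (m (dright I) + A k (dright I)).
  by rewrite /M (mA I); lra.
have M0 : 0 < M by rewrite ME addr_gt0.
have AS : A k.+1 I = lam I / C + (A k (dleft I) + A k (dright I)).
  by rewrite /A /= big_cons big_cat /= !mulrDl.
have lC : 0 <= lam I / C by rewrite divr_ge0 // ltW.
have split_le : x I ^+ 2 / M <= x (dleft I) ^+ 2 / (m (dleft I) + A k (dleft I))
    + x (dright I) ^+ 2 / (m (dright I) + A k (dright I)).
  by rewrite (xA I) ME convex_ratio.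
have gain : lam I * (x I / m I) ^+ 2 <=
    4 * C * (x I ^+ 2 / M - x I ^+ 2 / (M + lam I / C)).
  rewrite -subr_ge0.
  have Ma0 : 0 < M + lam I / C by rewrite ltr_wpDr.
  have le2m : M + lam I / C <= 2 * m I.
    by have := Am k.+1 I; rewrite AS /M; lra.
  have -> : 4 * C * (x I ^+ 2 / M - x I ^+ 2 / (M + lam I / C)) -
     lam I * (x I / m I) ^+ 2 = lam I * (x I / m I) ^+ 2 / (M * (M + lam I / C))
       * (4 * m I ^+ 2 - M * (M + lam I / C)).
    have MC : 0 < M * C + lam I by rewrite ltr_wpDr // mulr_gt0.
    by field; rewrite !lt0r_neq0.
  apply: mulr_ge0; first by apply: divr_ge0;
    rewrite mulr_ge0 ?sqr_ge0 // ltW.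
  nra.
apply: (@le_trans _ R (4 * C * (X I - x I ^+ 2 / (M + lam I / C)))).
  apply: (@le_trans _ R (4 * C * (x I ^+ 2 / M - x I ^+ 2 / (M + lam I / C)) +
     4 * C * (X I - x I ^+ 2 / M))); last by rewrite -mulrDr [X in _ * X]addrC addrA subrK.
  rewrite lerD // /B -mulrDr.
  apply: ler_wpM2l; first by rewrite mulr_ge0 // ltW.
  by rewrite (XA I) addrACA -opprD lerD2l lerN2.
by rewrite /B AS addrCA [lam I / C + _]addrC.
Qed.

(** The increment of x is its component along the Haar function adapted to m
    plus the average x / m times the increment of m. *)
Lemma increment_le m n x rho I : tree_additive m -> tree_additive x ->
  0 < rho I -> (forall J, 0 < m J) -> (forall J, 0 < n J) ->
  `|x (dright I) - x (dleft I)| <=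
    Num.sqrt (bessel m x I) * Num.sqrt (m I) +
    Num.sqrt (carleson_term m n rho I * (x I / m I) ^+ 2)
      / (2 * rho I * Num.sqrt (n I)).
Proof.
move=> mA xA r0 m0 n0.
have B0 := bessel_ge0 I mA xA m0.
set dx := x _ - x _; set dm := m (dright I) - m (dleft I).
have -> : Num.sqrt (carleson_term m n rho I * (x I / m I) ^+ 2) =
    (2 * rho I * Num.sqrt (n I)) * `|dm * (x I / m I)|.
  rewrite /carleson_term -/dm (_ : _ * _ =
    (2 * rho I) ^+ 2 * (n I * (dm * (x I / m I)) ^+ 2)); last by ring.
  rewrite sqrtrM ?sqr_ge0 // sqrtr_sqr sqrtrM ?ltW // sqrtr_sqr mulrA.
  by rewrite ger0_norm // mulr_ge0 // ltW.
rewrite mulrAC mulfV ?mul1r; last first.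
  by rewrite !mulf_neq0 // ?lt0r_neq0 // ?sqrtr_gt0.
rewrite -sqrtrM //.
apply: (@le_trans _ R (`|dx - dm * (x I / m I)| + `|dm * (x I / m I)|)).
  by rewrite -{1}(subrK (dm * (x I / m I)) dx) ler_normD.
rewrite lerD2r -sqrtr_sqr ler_wsqrtr // /bessel /dx /dm (xA I) (mA I).
have := m0 (dleft I); have := m0 (dright I).
move: (m _) (m _) (x _) (x _) => b a d c b0 a0.
rewrite -subr_ge0 (_ : _ - _ = ((c * b - d * a) / (a + b)) ^+ 2 * (a - b) ^+ 2
   / (a * b)).
  by apply: divr_ge0; rewrite mulr_ge0 ?sqr_ge0 // ltW.
by field; rewrite ?lt0r_neq0 // addr_gt0.
Qed.

Lemma carleson_term_ge0 m n rho I : 0 < n I -> 0 <= carleson_term m n rho I.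
Proof.
move=> n0; rewrite mulr_ge0 ?sqr_ge0 // mulr_ge0 ?(ltW n0) //.
by rewrite mulr_ge0 ?sqr_ge0.
Qed.

(** Multiplying out the two decompositions gives four terms.  In the first one
    rho sqrt (m n) is at most sqrt C1; the last one, the product of two Carleson
    terms, is divided by rho sqrt (m n), which is at least 1. *)
Lemma bilinear_term_le m n x y rho (C1 : R) I :
  tree_additive m -> tree_additive n -> tree_additive x -> tree_additive y ->
  (forall J, 0 < m J) -> (forall J, 0 < n J) -> 0 < rho I ->
  1 <= rho I ^+ 2 * m I * n I -> rho I ^+ 2 * m I * n I <= C1 ->
  let P := bessel m x I in
  let P' := carleson_term m n rho I * (x I / m I) ^+ 2 in
  let Q := bessel n y I in
  let Q' := carleson_term n m rho I * (y I / n I) ^+ 2 in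
  rho I * `|x (dright I) - x (dleft I)| * `|y (dright I) - y (dleft I)| <=
  Num.sqrt C1 * (Num.sqrt P * Num.sqrt Q)
  + 2^-1 * (Num.sqrt P * Num.sqrt Q') + 2^-1 * (Num.sqrt P' * Num.sqrt Q)
  + 4^-1 * (Num.sqrt P' * Num.sqrt Q').
Proof.
move=> mA nA xA yA m0 n0 r0 r1 rC.
have hx := increment_le mA xA r0 m0 n0.
have hy := increment_le nA yA r0 n0 m0.
set P := bessel m x I; set P' := carleson_term m n rho I * _.
set Q := bessel n y I; set Q' := carleson_term n m rho I * _.
rewrite /=.
have k1 : 1 <= rho I * Num.sqrt (m I) * Num.sqrt (n I).
  rewrite -(@ler_sqr _ 1) ?nnegrE ?mulr_ge0 ?sqrtr_ge0 ?(ltW r0) //.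
  by rewrite expr1n !exprMn !sqr_sqrtr ?(ltW (m0 _)) ?(ltW (n0 _)).
have kC : rho I * Num.sqrt (m I) * Num.sqrt (n I) <= Num.sqrt C1.
  rewrite -ler_sqr ?nnegrE ?mulr_ge0 ?sqrtr_ge0 ?(ltW r0) //.
  rewrite !exprMn !sqr_sqrtr ?(ltW (m0 _)) ?(ltW (n0 _)) //.
  by apply: le_trans rC; apply: le_trans r1.
move: hx hy k1 kC; rewrite -/P -/P' -/Q -/Q'.
have sm : 0 < Num.sqrt (m I) by rewrite sqrtr_gt0.
have sn : 0 < Num.sqrt (n I) by rewrite sqrtr_gt0.
have := sqrtr_ge0 P; have := sqrtr_ge0 Q; have := sqrtr_ge0 P'; have := sqrtr_ge0 Q'.
move: (Num.sqrt P) (Num.sqrt Q) (Num.sqrt P') (Num.sqrt Q') (Num.sqrt C1).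
move: r0 {P P' Q Q' r1 rC} sm sn.
move: (Num.sqrt (m I)) (Num.sqrt (n I)) (rho I) => a b r r0 a0 b0.
move=> p q p' q' c q'0 p'0 q0 p0 hx hy k1 kC.
apply: (@le_trans _ _ (r * (p * a + p' / (2 * r * b)) * (q * b + q' / (2 * r * a)))).
  by rewrite -[leLHS]mulrA -[leRHS]mulrA ler_wpM2l ?(ltW r0) //; apply: ler_pM.
have -> : r * (p * a + p' / (2 * r * b)) * (q * b + q' / (2 * r * a)) =
   (r * a * b) * (p * q) + 2^-1 * (p * q') + 2^-1 * (p' * q)
   + (r * a * b)^-1 * (4^-1 * (p' * q')).
  by field; rewrite !lt0r_neq0.
have k0 : 0 < r * a * b by rewrite !mulr_gt0.
have pq' : 0 <= 4^-1 * (p' * q') by rewrite !mulr_ge0.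
rewrite lerD //; first by rewrite !lerD2r ler_wpM2r ?mulr_ge0.
by rewrite ler_piMl // invf_le1.
Qed.

Lemma bilinear_sum_le m n x y rho (C1 : R) (s : seq dyadic) :
  tree_additive m -> tree_additive n -> tree_additive x -> tree_additive y ->
  (forall J, 0 < m J) -> (forall J, 0 < n J) -> (forall J, 0 < rho J) ->
  (forall J, 1 <= rho J ^+ 2 * m J * n J) ->
  (forall J, rho J ^+ 2 * m J * n J <= C1) ->
  let A := Num.sqrt (\sum_(J <- s) bessel m x J) in
  let A' := Num.sqrt (\sum_(J <- s) carleson_term m n rho J * (x J / m J) ^+ 2) in
  let B := Num.sqrt (\sum_(J <- s) bessel n y J) in
  let B' := Num.sqrt (\sum_(J <- s) carleson_term n m rho J * (y J / n J) ^+ 2) in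
  \sum_(J <- s) rho J * `|x (dright J) - x (dleft J)| *
    `|y (dright J) - y (dleft J)| <=
  Num.sqrt C1 * (A * B) + 2^-1 * (A * B') + 2^-1 * (A' * B) + 4^-1 * (A' * B')
  :> R.
Proof.
move=> mA nA xA yA m0 n0 r0 r1 rC /=.
have h I := bilinear_term_le mA nA xA yA m0 n0 (r0 I) (r1 I) (rC I).
apply: (le_trans (ler_sum _ (fun I _ => h I))).
rewrite [leLHS]big_split [X in X + _ <= _]big_split [X in X + _ + _ <= _]big_split.
rewrite /= -!mulr_sumr.
have P0 I := bessel_ge0 I mA xA m0.
have Q0 I := bessel_ge0 I nA yA n0.
have P'0 I : 0 <= carleson_term m n rho I * (x I / m I) ^+ 2.
  by rewrite mulr_ge0 ?sqr_ge0 // carleson_term_ge0.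
have Q'0 I : 0 <= carleson_term n m rho I * (y I / n I) ^+ 2.
  by rewrite mulr_ge0 ?sqr_ge0 // carleson_term_ge0.
have i2 : 0 <= 2^-1 :> R by [].
have i4 : 0 <= 4^-1 :> R by [].
by rewrite !lerD // ler_wpM2l ?sqrtr_ge0 //; apply: sum_sqrt_CS.
Qed.
End tree_estimates.

(** * Dyadic intervals and integrals over them *)

Section dyadic_geometry.
Context {R : realType}.
Local Notation mu := (@lebesgue_measure R).
Implicit Types (I J : dyadic).

Lemma dlen_gt0 I : 0 < dlen I :> R.
Proof. by rewrite /dlen exprz_gt0. Qed.

Lemma dlen_child (i k l : int) : dlen (i, k) = 2 * dlen (i + 1, l) :> R.
Proof.
rewrite /dlen /= -{2}(expr1z 2) -expfzDr //; congr (_ ^ _); lia.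
Qed.

Lemma dlen_descendant (i k l : int) (d : nat) :
  dlen (i, k) = (2 ^ d)%N%:R * dlen (i + d%:Z, l) :> R.
Proof.
rewrite /dlen /= natrX -[X in X * _]/(2 ^ d%:Z) -expfzDr //.
by congr (_ ^ _); lia.
Qed.

Lemma in_ditv I (x : R) : ditv I x <->
  dlen I * I.2%:~R <= x /\ x < dlen I * (I.2 + 1)%:~R.
Proof.
by rewrite /ditv /= in_itv /=; split => [/andP[]|[-> ->]].
Qed.

Lemma measurable_ditv I : measurable (ditv I : set (measurableTypeR R)).
Proof. exact: measurable_itv. Qed.

Lemma mu_ditv I : mu (ditv I) = (dlen I)%:E.
Proof.
rewrite /ditv lebesgue_measure_itv /= lte_fin ltr_pM2l ?dlen_gt0 //.
rewrite ltr_int ltrDl ltr01 -EFinB -mulrBr intrD addrAC subrr add0r.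
by rewrite mulr1.
Qed.

Lemma ditv_child I (x : R) :
  ditv I x <-> ditv (dleft I) x \/ ditv (dright I) x.
Proof.
case: I => [i k]; rewrite !in_ditv /dleft /dright /=.
have e1 := @dlen_child i k (2 * k); have e2 := @dlen_child i k (2 * k + 1).
have d0 := dlen_gt0 (i + 1, 2 * k).
have e12 : dlen (i + 1, 2 * k + 1) = dlen (i + 1, 2 * k) :> R by lra.
rewrite e12 e1 !intrD !intrM.
move: (dlen _) d0 => D d0; move: (k%:~R : R) => K.
split; last by case=> -[]; split; lra.
case=> h1 h2; have [lt|ge] := ltP x (D * (2 * K + 1)).
  by left; split; lra.
by right; split; lra.
Qed.

Lemma ditv_children_disjoint I (x : R) :
  ditv (dleft I) x -> ditv (dright I) x -> False.
Proof.
case: I => [i k]; rewrite !in_ditv /dleft /dright /=.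
rewrite /dlen /= => -[_ lt] [ge _].
by move: (le_lt_trans ge lt); rewrite ltxx.
Qed.

Lemma ditv_descendant (i k l : int) (d : nat) (x : R) :
  ditv (i + d%:Z, l) x ->
  (ditv (i, k) x <->
   (2 ^ d)%N%:Z * k <= l /\ l < (2 ^ d)%N%:Z * (k + 1)).
Proof.
rewrite !in_ditv /=.
have -> := @dlen_descendant i k l d.
have d0 := dlen_gt0 (i + d%:Z, l).
move: (dlen _) d0 => D d0 [h1 h2].
have E (z : int) : (2 ^ d)%N%:R * D * z%:~R = D * ((2 ^ d)%N%:Z * z)%:~R.
  by rewrite intrM mulrCA mulrA.
rewrite !E; split => -[h3 h4].
  have := le_lt_trans h3 h2; have := le_lt_trans h1 h4.
  by rewrite !ltr_pM2l // !ltr_int; lia.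
split; first by apply: le_trans h1; rewrite ler_pM2l // ler_int.
by apply: (lt_le_trans h2); rewrite ler_pM2l // ler_int; lia.
Qed.

Lemma subtree_sub k I J : J \in subtree k I -> @ditv R J `<=` ditv I.
Proof.
case: I J => [i k'] [j l] /mem_subtree [d [_ /= -> e2 e3]] x xJ.
by apply/(ditv_descendant k' xJ).
Qed.

Lemma ditv_sub_closed I : @ditv R I `<=`
  `[dlen I * I.2%:~R, dlen I * (I.2 + 1)%:~R]%classic.
Proof.
by move=> x; rewrite in_ditv /= in_itv /= => -[-> /ltW ->].
Qed.

Lemma halflines_disjoint (N : nat) (x : R) :
  ditv (- N%:Z, 0) x -> ditv (- N%:Z, - 1) x -> False.
Proof.
rewrite !in_ditv /dlen /= => -[ge _] [_ lt].
by move: (le_lt_trans ge lt); rewrite addNr ltxx.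
Qed.
End dyadic_geometry.

Section integrals.
Context {R : realType}.
Local Notation mu := (@lebesgue_measure R).
Implicit Types (D E : set (measurableTypeR R)) (f g k v : R -> R) (I J : dyadic).

Definition rintegrable D f := mu.-integrable D (EFin \o f).

Lemma rintegrableD D f g : measurable D -> rintegrable D f ->
  rintegrable D g -> rintegrable D (fun x => f x + g x).
Proof. by move=> mD fi gi; apply: integrableD fi gi. Qed.

Lemma rintegrableB D f g : measurable D -> rintegrable D f ->
  rintegrable D g -> rintegrable D (fun x => f x - g x).
Proof. by move=> mD fi gi; apply: integrableB fi gi. Qed.

Lemma rintegrableZ D f (c : R) : measurable D -> rintegrable D f ->
  rintegrable D (fun x => c * f x).
Proof. by move=> mD fi; apply: integrableZl fi. Qed.

Lemma rintegrable_sum D (T : Type) (s : seq T) (h : T -> R -> R) :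
  measurable D -> (forall i, rintegrable D (h i)) ->
  rintegrable D (fun x => \sum_(i <- s) h i x).
Proof.
move=> mD hi; elim: s => [|i s IHs].
  under eq_fun do rewrite big_nil.
  exact: integrable0.
under eq_fun do rewrite big_cons.
exact: rintegrableD.
Qed.

Lemma rintegrable_le D f g : measurable D -> measurable_fun D f ->
  (forall x, D x -> `|f x| <= g x) -> rintegrable D g -> rintegrable D f.
Proof.
move=> mD mf fg gi; apply: le_integrable gi => //.
  exact/measurable_EFinP.
move=> x Dx /=; rewrite lee_fin; apply: le_trans (fg x Dx) _.
exact: ler_norm.
Qed.

Lemma rintegrableS D E f : measurable D -> measurable E -> E `<=` D ->
  rintegrable D f -> rintegrable E f.
Proof. by move=> mD mE ED; exact: integrableS. Qed.

Lemma rintegrable_measurable D f : rintegrable D f -> measurable_fun D f.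
Proof. by move/(measurable_int mu)/measurable_EFinP. Qed.

Lemma Rintegral_sum D (T : Type) (s : seq T) (h : T -> R -> R) :
  measurable D -> (forall i, rintegrable D (h i)) ->
  \int[mu]_(x in D) (\sum_(i <- s) h i x) =
  \sum_(i <- s) \int[mu]_(x in D) h i x.
Proof.
move=> mD hi; elim: s => [|i s IHs].
  under eq_Rintegral do rewrite big_nil.
  by rewrite big_nil Rintegral_cst // mul0r.
under eq_Rintegral do rewrite big_cons.
by rewrite big_cons RintegralD ?IHs //; [exact: hi|exact: rintegrable_sum].
Qed.

Lemma EFin_Rintegral D f : measurable D -> rintegrable D f ->
  (\int[mu]_(x in D) f x)%:E = (\int[mu]_(x in D) (f x)%:E)%E.
Proof. by move=> mD fi; rewrite /Rintegral fineK // integrable_fin_num. Qed.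

Definition dloc f := forall I, rintegrable (ditv I) f.
Definition dint f I : R := \int[mu]_(x in ditv I) f x.

Lemma locally_integrable_dloc f : locally_integrable setT f -> dloc f.
Proof.
move=> [mf _ foo] I; apply: (rintegrableS _ (measurable_ditv I) (@ditv_sub_closed R I)); first exact: measurable_itv.
apply/integrableP; split.
  by apply/measurable_EFinP; exact: measurable_funTS.
by apply: (foo _ (@subsetT _ _)); exact: segment_compact.
Qed.

Lemma dloc_cst (c : R) : dloc (fun=> c).
Proof.
move=> I; apply/integrableP; split; first exact/measurable_EFinP.
have mI := @measurable_ditv R I.
rewrite /= integral_cst //.
by rewrite [X in (_ * X)%E](mu_ditv I) -EFinM ltry.
Qed.

Lemma rintegrable_dloc f : rintegrable setT f -> dloc f.
Proof.
by move=> fi I; apply: rintegrableS fi => //; exact: measurable_ditv.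
Qed.

Lemma dint_additive f : dloc f -> tree_additive (dint f).
Proof.
move=> fl I; rewrite /dint.
have -> : ditv I = ditv (dleft I) `|` ditv (dright I) :> set R.
  by apply/seteqP; split => x /ditv_child.
rewrite Rintegral_setU //; try exact: measurable_ditv.
  suff -> : ditv (dleft I) `|` ditv (dright I) = ditv I :> set R by exact: fl.
  by apply/seteqP; split => x /ditv_child.
apply/disj_setPS => x [xl xr]; exact: (ditv_children_disjoint xl xr).
Qed.

Lemma integral_ditv_gt0 f I : measurable_fun (ditv I : set (measurableTypeR R)) f ->
  (forall x, 0 < f x) -> (0 < \int[mu]_(x in ditv I) (f x)%:E)%E.
Proof.
move=> mf f0.
have : (0 <= \int[mu]_(x in ditv I) (f x)%:E)%E.
  by apply: integral_ge0 => x _; rewrite lee_fin ltW.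
rewrite le_eqVlt => /predU1P[e0|//]; exfalso.
have : (\int[mu]_(x in ditv I) `|(f x)%:E| = 0)%E.
  by under eq_integral do rewrite gee0_abs ?lee_fin ?(ltW (f0 _)) //.
have /measurable_EFinP mf' := mf.
move/(ae_eq_integral_abs mu (measurable_ditv I) mf') => -[N [mN N0 sN]].
have : (mu (ditv I) <= mu N)%E.
  apply: le_measure; rewrite ?inE //; first exact: measurable_ditv.
  move=> x xI; apply: sN => /(_ xI) [] /eqP.
  by rewrite gt_eqF.
by rewrite N0 mu_ditv lee_fin leNgt dlen_gt0.
Qed.

Lemma dint_gt0 f I : dloc f -> (forall x, 0 < f x) -> 0 < dint f I.
Proof.
move=> fl f0; rewrite -lte_fin EFin_Rintegral //; last exact: measurable_ditv.
apply: integral_ditv_gt0 => //; exact: rintegrable_measurable.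
Qed.

Lemma avg_dint f I : dloc f -> avg f I = ((dlen I)^-1 * dint f I)%:E.
Proof.
by move=> fl; rewrite /avg -EFin_Rintegral //; exact: measurable_ditv.
Qed.

Lemma delta_dint f I : dloc f ->
  delta f I = (2 / dlen I * (dint f (dright I) - dint f (dleft I)))%:E.
Proof.
move=> fl; rewrite /delta !avg_dint // -EFinB; congr EFin.
case: I => i k; rewrite (@dlen_child R i k (2 * k)) /dleft /dright /=.
have -> : dlen (i + 1, 2 * k + 1) = dlen (i + 1, 2 * k) :> R by [].
by field; rewrite lt0r_neq0 // dlen_gt0.
Qed.

Lemma rintegrable_indic f I : dloc f ->
  rintegrable setT (fun x => f x * \1_(ditv I) x).
Proof.
move=> fl; have /(integrable_mkcond _ (measurable_ditv I)) := fl I.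
apply: eq_integrable => // x _.
by rewrite /= /patch indicE; case: (x \in _); rewrite ?mulr1 ?mulr0.
Qed.

Lemma Rintegral_indic f I : \int[mu]_x (f x * \1_(ditv I) x) = dint f I.
Proof.
rewrite /dint [RHS]Rintegral_mkcond; apply: eq_Rintegral => x _.
by rewrite /= /patch indicE; case: (x \in _); rewrite ?mulr1 ?mulr0.
Qed.

Lemma mul_haarE f I x : f x * haar I x = (Num.sqrt (dlen I))^-1 *
  (f x * \1_(ditv (dright I)) x - f x * \1_(ditv (dleft I)) x).
Proof. by rewrite /haar mulrCA mulrBr. Qed.

Lemma rintegrable_haar f I : dloc f -> rintegrable setT (fun x => f x * haar I x).
Proof.
move=> fl; under eq_fun do rewrite mul_haarE.
by apply: rintegrableZ => //; apply: rintegrableB => //; exact: rintegrable_indic.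
Qed.

Lemma haar_coefE f I : dloc f ->
  haar_coef f I = (Num.sqrt (dlen I))^-1 * (dint f (dright I) - dint f (dleft I)).
Proof.
move=> fl; rewrite /haar_coef; under eq_Rintegral do rewrite mul_haarE.
rewrite RintegralZl //; last by apply: rintegrableB => //; exact: rintegrable_indic.
by rewrite RintegralB ?Rintegral_indic //; exact: rintegrable_indic.
Qed.

Lemma measurable_haar I : measurable_fun setT (@haar R I).
Proof.
apply: measurable_funM => //; apply: measurable_funB;
  exact: measurable_indic (measurable_ditv _).
Qed.

Lemma haar_sqr I x : haar I x ^+ 2 = (dlen I)^-1 * \1_(ditv I) x :> R.
Proof.
rewrite /haar exprMn exprVn sqr_sqrtr ?(ltW (dlen_gt0 _)) //; congr (_ * _).
have := @ditv_child R I x; have := @ditv_children_disjoint R I x.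
rewrite !indicE; case: (boolP (x \in ditv (dright I))) => [/set_mem xr|/negP xr];
  case: (boolP (x \in ditv (dleft I))) => [/set_mem xl|/negP xl] D C.
- by exfalso; exact: D.
- by rewrite mem_set ?subr0 ?expr1n //; apply/C; right.
- by rewrite mem_set ?sub0r ?sqrrN ?expr1n //; apply/C; left.
- rewrite memNset ?subrr ?expr0n //=.
  by move/C => -[] /mem_set.
Qed.

(** * Finite Haar sums *)

Definition hsum (c : dyadic -> R) (s : seq dyadic) (x : R) :=
  \sum_(I <- s) c I * haar I x.

Lemma measurable_hsum c s : measurable_fun setT (hsum c s).
Proof.
apply: measurable_sum => I; apply: measurable_funM => //; exact: measurable_haar.
Qed.

Lemma mul_hsumE f c s x : f x * hsum c s x = \sum_(I <- s) c I * (f x * haar I x).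
Proof. by rewrite /hsum mulr_sumr; apply: eq_bigr => I _; rewrite mulrCA. Qed.

Lemma rintegrable_hsum f c s : dloc f ->
  rintegrable setT (fun x => f x * hsum c s x).
Proof.
move=> fl; under eq_fun do rewrite mul_hsumE.
by apply: rintegrable_sum => // I; apply: rintegrableZ => //; exact: rintegrable_haar.
Qed.

Lemma Rintegral_hsum f c s : dloc f ->
  \int[mu]_x (f x * hsum c s x) = \sum_(I <- s) c I * haar_coef f I.
Proof.
move=> fl; under eq_Rintegral do rewrite mul_hsumE.
rewrite Rintegral_sum // => [|I]; last first.
  by apply: rintegrableZ => //; exact: rintegrable_haar.
by apply: eq_bigr => I _; rewrite RintegralZl //; exact: rintegrable_haar.
Qed.

End integrals.

(** * The weighted quadratic energy and its completeness *)

Section energy.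
Context {R : realType}.
Local Notation mu := (@lebesgue_measure R).
Implicit Types (f g u w : R -> R).

Definition energy u f : \bar R := (\int[mu]_x (f x ^+ 2 * u x)%:E)%E.

Lemma L2norm_energy u f : L2norm u f = sqrte (energy u f).
Proof.
rewrite /L2norm /energy; congr sqrte.
by apply: eq_integral => x _; rewrite real_normK ?num_real.
Qed.

Variable u : R -> R.
Hypothesis mes_u : measurable_fun setT u.
Hypothesis u_gt0 : forall x, 0 < u x.

Let ge0 f x : (0 <= (f x ^+ 2 * u x)%:E)%E.
Proof. by rewrite lee_fin mulr_ge0 ?sqr_ge0 // ltW. Qed.

Let meas f : measurable_fun setT f ->
  measurable_fun (setT : set (measurableTypeR R)) (fun x => (f x ^+ 2 * u x)%:E).
Proof.
by move=> mf; apply/measurable_EFinP/measurable_funM => //; exact: measurable_funX.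
Qed.

Lemma energy_ge0 f : (0 <= energy u f)%E.
Proof. by apply: integral_ge0 => x _; exact: ge0. Qed.

Lemma energyZ f (c : R) : measurable_fun setT f ->
  energy u (fun x => c * f x) = ((c ^+ 2)%:E * energy u f)%E.
Proof.
move=> mf; rewrite /energy -ge0_integralZl //; last by rewrite lee_fin sqr_ge0.
- by apply: eq_integral => x _; rewrite -EFinM; congr EFin; ring.
- exact: meas.
Qed.

Lemma energy_parallelogram f g : measurable_fun setT f -> measurable_fun setT g ->
  (energy u (fun x => f x + g x)%R + energy u (fun x => f x - g x)%R =
   2%:E * energy u f + 2%:E * energy u g)%E.
Proof.
move=> mf mg; rewrite /energy.
have two (h : R -> R) : measurable_fun setT h -> (2%:E * \int[mu]_x (h x ^+ 2 * u x)%:E =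
    \int[mu]_x (2%:E * (h x ^+ 2 * u x)%:E))%E.
  by move=> mh; rewrite ge0_integralZl //; exact: meas.
rewrite (two f) // (two g) // -!ge0_integralD //.
- by apply: eq_integral => x _; rewrite -!EFinM -!EFinD; congr EFin; ring.
- by move=> x _; rewrite mule_ge0.
- by apply: measurable_funeM; exact: meas.
- by move=> x _; rewrite mule_ge0.
- by apply: measurable_funeM; exact: meas.
- by move=> x _; exact: (ge0 (fun x => f x + g x)).
- by apply: (@meas (fun x => f x + g x)); exact: measurable_funD.
- by move=> x _; exact: (ge0 (fun x => f x - g x)).
- by apply: (@meas (fun x => f x - g x)); exact: measurable_funB.
Qed.

Lemma energyD_le f g : measurable_fun setT f -> measurable_fun setT g ->
  (energy u (fun x => f x + g x)%R <= 2%:E * energy u f + 2%:E * energy u g)%E.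
Proof.
move=> mf mg; rewrite -energy_parallelogram // leeDl //; exact: energy_ge0.
Qed.

Lemma energyB_le f g : measurable_fun setT f -> measurable_fun setT g ->
  (energy u (fun x => f x - g x)%R <= 2%:E * energy u f + 2%:E * energy u g)%E.
Proof.
move=> mf mg; rewrite -energy_parallelogram // leeDr //; exact: energy_ge0.
Qed.

Lemma energy_fatou (h : nat -> R -> R) g (b : \bar R) :
  (forall n, measurable_fun setT (h n)) -> measurable_fun setT g ->
  {ae mu, forall x, h n x @[n --> \oo] --> g x} ->
  (forall n, energy u (h n) <= b)%E -> (energy u g <= b)%E.
Proof.
move=> mh mg hg hb.
have -> : energy u g = (\int[mu]_x limn_einf (fun n => (h n x ^+ 2 * u x)%:E))%E.
  apply: ge0_ae_eq_integral => //.
  - exact: meas.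
  - apply: measurableT_comp => //; apply: measurable_fun_limn_esup => n.
    by apply: measurableT_comp => //; exact: meas.
  - move=> x _; rewrite limn_einf_lim; apply: lime_ge; first exact: is_cvg_einfs.
    by near=> n; apply: le_ereal_inf_tmp => _ [k _ <-]; exact: ge0.
  - case: hg => N [mN N0 sN]; exists N; split => // x /= nx; apply: sN => hgx.
    apply: nx => _; apply/esym.
    apply: (cvg_limn_einf_sup _).1; apply: cvg_EFin; first by near=> n.
    by apply: cvgM; [rewrite expr2; apply: cvgM|exact: cvg_cst].
apply: le_trans (fatou _ _ _ _) _ => //; first by move=> n; exact: meas.
rewrite limn_einf_lim; apply: lime_le; first exact: is_cvg_einfs.
by near=> n; apply: le_trans (hb n); apply: ereal_inf_lbound; exists n => /=.
Unshelve. all: by end_near. Qed.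
End energy.

Section completeness.
Context {R : realType}.
Local Notation mu := (@lebesgue_measure R).
Variable u : R -> R.
Hypothesis mes_u : measurable_fun setT u.
Hypothesis u_gt0 : forall x, 0 < u x.

(** If the energies of the increments decrease geometrically, the sequence
    converges almost everywhere: |d_k| <= 2^-k + 2^k d_k^2, and the right-hand
    sides have a finite sum at almost every point. *)
Lemma ae_cvg_geometric_energy (h : nat -> R -> R) :
  (forall k, measurable_fun setT (h k)) ->
  (forall k, energy u (fun x => h k.+1 x - h k x)%R <= (4^-1 ^+ k)%:E)%E ->
  {ae mu, forall x, cvgn (fun n => h n x)}.
Proof.
move=> mh he.
pose e k x : \bar R := (2 ^+ k * ((h k.+1 x - h k x) ^+ 2 * u x))%:E.
have e0 k x : (0 <= e k x)%E.
  by rewrite lee_fin mulr_ge0 ?exprn_ge0 // mulr_ge0 ?sqr_ge0 // ltW.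
have md k : measurable_fun setT (fun x => h k.+1 x - h k x).
  exact: measurable_funB.
have mdu k : measurable_fun (setT : set (measurableTypeR R))
    (fun x => ((h k.+1 x - h k x) ^+ 2 * u x)%:E).
  by apply/measurable_EFinP/measurable_funM => //; apply: measurable_funX; exact: md.
have me k : measurable_fun (setT : set (measurableTypeR R)) (e k).
  apply/measurable_EFinP/measurable_funM => //.
  by apply/measurable_EFinP; exact: mdu.
have ie k : (\int[mu]_x e k x <= (2 / (2 ^ (k + 1))%:R)%:E)%E.
  have -> : (\int[mu]_x e k x = (2 ^+ k)%:E * energy u (fun x => h k.+1 x - h k x)%R)%E.
    rewrite /energy -ge0_integralZl //.
    by move=> x _; rewrite lee_fin mulr_ge0 ?sqr_ge0 // ltW.
  apply: (@le_trans _ _ ((2 ^+ k)%:E * (4^-1 ^+ k)%:E)%E).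
    by apply: lee_wpmul2l (he k); rewrite lee_fin exprn_ge0.
  rewrite -EFinM lee_fin natrX addn1 exprS invfM mulVKf //.
  by rewrite -exprMn (_ : 2 * 4^-1 = 2^-1) ?exprVn //; lra.
have ise : (\int[mu]_x (\sum_(k <oo) e k x) < +oo)%E.
  rewrite integral_nneseries //.
  apply: (@le_lt_trans _ _ (\sum_(k <oo) (2 / (2 ^ (k + 1))%:R)%:E)%E).
    by apply: lee_nneseries => // k _ _; exact: integral_ge0.
  by rewrite (cvg_lim _ (@cvg_geometric_eseries_half R 2 0)) ?ltry.
have : mu.-integrable setT (fun x => \sum_(k <oo) e k x)%E.
  apply/integrableP; split; first by apply: ge0_emeasurable_sum => // k _.
  under eq_integral do rewrite gee0_abs ?nneseries_ge0 //.
  by [].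
move/(integrable_ae measurableT) => [N [mN N0 sN]].
exists N; split => // x /= ncvg; apply: sN => /(_ I) fin; apply: ncvg.
pose d k := h k.+1 x - h k x.
have cd : cvgn (series d).
  apply: normed_cvg; apply: nondecreasing_is_cvgn.
    by apply: nondecreasing_series => k _ _ /=.
  exists (2 + fine (\sum_(k <oo) e k x) / u x) => _ [n _ <-]; rewrite /series /=.
  apply: (@le_trans _ _ (\sum_(0 <= k < n) (2 / (2 ^ (k + 1))%:R) +
     (\sum_(0 <= k < n) 2 ^+ k * (d k ^+ 2 * u x)) / u x)).
    rewrite mulr_suml -big_split /=; apply: ler_sum => k _.
    rewrite mulrA mulfK ?lt0r_neq0 // natrX addn1 exprS invfM mulVKf //.
    have a0 : 0 < 2 ^+ k :> R by rewrite exprn_gt0.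
    move: (2 ^+ k) a0 => a a0.
    have aV : a * a^-1 = 1 by rewrite mulfV ?lt0r_neq0.
    have i0 : 0 < a^-1 by rewrite invr_gt0.
    rewrite -(real_normK (num_real (d k))) /d -/(d k).
    have := sqr_ge0 (`|d k| - a^-1); have := normr_ge0 (d k).
    move: (`|d k|) (a^-1) aV i0 => y b ab b0 y0 sq.
    have : 0 <= a * (y - b) ^+ 2 by rewrite mulr_ge0 // ltW.
    have -> : a * (y - b) ^+ 2 = a * y ^+ 2 - 2 * (a * b) * y + (a * b) * b by ring.
    by rewrite ab; lra.
  apply: lerD.
    rewrite -lee_fin -sumEFin.
    have <- : (\sum_(k <oo) (2 / (2 ^ (k + 1))%:R : R)%:E)%E = 2%:E.
      by rewrite (cvg_lim _ (@cvg_geometric_eseries_half R 2 0)) // expr0 divr1.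
    by apply: nneseries_lim_ge.
  rewrite ler_wpM2r ?invr_ge0 ?(ltW (u_gt0 x)) // -lee_fin fineK // -sumEFin.
  by apply: nneseries_lim_ge => k _ _; exact: e0.
have -> : (fun n => h n x) = (fun n => h 0%N x + series d n).
  apply/funext => n.
  by rewrite (_ : d = telescope (fun n => h n x)) // telescopeK /= addrC subrK.
by apply: is_cvgD => //; exact: is_cvg_cst.
Qed.

(** Riesz-Fischer for nets indexed by finite sets: a sequence of finite sets is
    extracted along which the net converges almost everywhere, and Fatou's
    lemma transfers the Cauchy bounds to the limit. *)
Lemma energy_complete (T : choiceType) (S : {fset T} -> R -> R) :
  (forall F, measurable_fun setT (S F)) ->
  (forall e : R, 0 < e -> exists F0 : {fset T}, forall F : {fset T},
     (F0 `<=` F)%fset -> (energy u (fun x => S F x - S F0 x)%R <= e%:E)%E) ->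
  exists g : R -> R, [/\ measurable_fun setT g,
    (forall e : R, 0 < e -> exists F0 : {fset T}, forall F : {fset T},
     (F0 `<=` F)%fset -> (energy u (fun x => S F x - g x)%R <= e%:E)%E) &
    (forall B : \bar R, (forall F, energy u (S F) <= B)%E -> (energy u g <= B)%E)].
Proof.
move=> mS cauchy.
have d0 k : 0 < 4^-1 * 4^-1 ^+ k :> R by rewrite mulr_gt0 ?exprn_gt0.
have [G0 G0P] := choice (fun k : nat => cauchy _ (d0 k)).
pose G := fix G k := if k is k'.+1 then (G k' `|` G0 k)%fset else G0 0%N.
have mB F F' : measurable_fun setT (fun x => S F x - S F' x).
  exact: measurable_funB.
have G0G k : (G0 k `<=` G k)%fset by case: k => [|k] //=; exact: fsubsetUr.
have GS k : (G k `<=` G k.+1)%fset by exact: fsubsetUl.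
have GP k F : (G k `<=` F)%fset ->
    (energy u (fun x => S F x - S (G k) x)%R <= (4^-1 ^+ k)%:E)%E.
  move=> GF.
  have -> : (fun x => S F x - S (G k) x) =
      (fun x => (S F x - S (G0 k) x) - (S (G k) x - S (G0 k) x)).
    by apply/funext => x; lra.
  apply: (le_trans (energyB_le mes_u u_gt0 (mB _ _) (mB _ _))).
  apply: (@le_trans _ _ (2%:E * (4^-1 * 4^-1 ^+ k)%:E + 2%:E * (4^-1 * 4^-1 ^+ k)%:E)%E).
    apply: leeD; apply: lee_wpmul2l => //; apply: G0P => //.
    exact: fsubset_trans GF.
  by rewrite -!EFinM -EFinD lee_fin; lra.
have Gm k n : (G k `<=` G (n + k)%N)%fset.
  by elim: n => [|n IHn] //; apply: fsubset_trans IHn _; exact: GS.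
have aecvg := ae_cvg_geometric_energy (fun k => mS (G k)) (fun k => GP k _ (GS k)).
pose g x := fine (limn_esup (fun n => (S (G n) x)%:E)).
have mg : measurable_fun setT g.
  apply: (measurableT_comp (fine_measurable measurableT)).
  by apply: measurable_fun_limn_esup => n; apply/measurable_EFinP.
have aeg : {ae mu, forall x, S (G n) x @[n --> \oo] --> g x}.
  case: aecvg => N [mN N0 sN]; exists N; split => // x /= nx; apply: sN => cx.
  apply: nx; rewrite /g.
  have cE : ((S (G n) x)%:E @[n --> \oo] --> (limn (fun n => S (G n) x))%:E)%E.
    by apply: cvg_EFin => //; near=> n.
  by rewrite (cvg_limn_einf_sup cE).2.
exists g; split => //; last first.
  by move=> B SB; exact: (energy_fatou mes_u u_gt0 (fun k => mS (G k)) mg aeg).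
move=> e e0.
have [k ke] : exists k : nat, 4 * 4^-1 ^+ k <= e.
  have lt1 : `|4^-1 : R| < 1 by rewrite ger0_norm // invf_lt1 // ltr1n.
  have e4 : 0 < e / 4 by rewrite divr_gt0.
  have /cvgrPdist_le /(_ _ e4) [k _ /(_ k (leqnn k))] :=
    @cvg_geometric R 1 4^-1 lt1.
  rewrite /geometric /= mul1r sub0r normrN ger0_norm ?exprn_ge0 // => le.
  by exists k; lra.
exists (G k) => F GF.
apply: (energy_fatou mes_u u_gt0 (h := fun n x => S F x - S (G (n + k)%N) x)) => //.
- by apply: measurable_funB.
- case: aeg => N [mN N0 sN]; exists N; split => // x /= nx; apply: sN => cx.
  apply: nx; apply: cvgB; first exact: cvg_cst.
  by rewrite (cvg_shiftn k (fun n => S (G n) x)).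
- move=> n.
  have -> : (fun x => S F x - S (G (n + k)%N) x) =
      (fun x => (S F x - S (G k) x) - (S (G (n + k)%N) x - S (G k) x)).
    by apply/funext => x; lra.
  apply: (le_trans (energyB_le mes_u u_gt0 (mB _ _) (mB _ _))).
  apply: (@le_trans _ _ (2%:E * (4^-1 ^+ k)%:E + 2%:E * (4^-1 ^+ k)%:E)%E).
    by apply: leeD; apply: lee_wpmul2l => //; apply: GP => //; exact: Gm.
  by rewrite -!EFinM -EFinD lee_fin; lra.
Unshelve. all: by end_near. Qed.
End completeness.

(** * The hypotheses of the theorem as conditions on dyadic integrals *)

Section conditions.
Context {R : realType}.
Local Notation mu := (@lebesgue_measure R).
Implicit Types (f g u w nu v : R -> R) (I J : dyadic) (t C : R).

(** The coefficient by which the multiplier acts on the Haar function of I,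
    once the factor w(x)^t has been moved into the target weight. *)
Definition symbol w t I : R := (fine (avg w I) `^ t)^-1.

(** Dividing by the length turns the averages in the conditions into integrals. *)
Definition density_symbol w t I : R := symbol w t I / dlen I.

Lemma measurable_inv_weight u : measurable_fun setT u ->
  measurable_fun setT (inv_weight u).
Proof.
move=> mf.
have -> : inv_weight u = (fun x => u x * (u x ^+ 2) `^ (-1)).
  apply/funext => x; rewrite /inv_weight powR_inv1 ?sqr_ge0 //.
  have [->|ux] := eqVneq (u x) 0; first by rewrite invr0 mul0r.
  by field.
apply: measurable_funM => //; apply: (measurableT_comp (measurable_powR _)).
exact: measurable_funX.
Qed.

Lemma measurable_mul_weight u w t : measurable_fun setT u ->
  measurable_fun setT w -> measurable_fun setT (mul_weight u w t).
Proof.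
move=> mf mw; apply: measurable_funM => //.
exact: (measurableT_comp (measurable_powR _)).
Qed.

Lemma symbol_sqr w t I : (fine (avg w I) `^ (2 * t))^-1 = symbol w t I ^+ 2.
Proof.
by rewrite /symbol exprVn mulrC powRrM powR_mulrn // powR_ge0.
Qed.

Lemma avg_gt0 w I : dloc w -> (forall x, 0 < w x) -> 0 < fine (avg w I).
Proof.
by move=> wl w0; rewrite avg_dint //= mulr_gt0 ?invr_gt0 ?dlen_gt0 ?dint_gt0.
Qed.

Lemma symbol_gt0 w t I : dloc w -> (forall x, 0 < w x) -> 0 < symbol w t I.
Proof. by move=> wl w0; rewrite invr_gt0 powR_gt0 // avg_gt0. Qed.

Lemma density_symbol_gt0 w t I : dloc w -> (forall x, 0 < w x) ->
  0 < density_symbol w t I.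
Proof. by move=> wl w0; rewrite divr_gt0 ?symbol_gt0 ?dlen_gt0. Qed.

(** Bernoulli's inequality: these are the exponents for which z |-> z^t is convex,
    hence above its tangent at 1. *)
Lemma powR_ge_tangent (z t : R) : 0 < z -> t <= 0 \/ 1 <= t ->
  1 + t * (z - 1) <= z `^ t.
Proof.
move=> z0.
have lnle (y : R) : 0 < y -> ln y <= y - 1.
  move=> y0; have := @le_ln1Dx R (y - 1); rewrite (_ : 1 + (y - 1) = y); last by ring.
  by apply; rewrite ltrBrDr addNr.
have powRE (s : R) : z `^ s = expR (s * ln z) by rewrite /powR gt_eqF.
case=> ht.
  rewrite powRE; apply: le_trans (expR_ge1Dx _).
  by rewrite lerD2l; apply: ler_wnM2l => //; exact: lnle.
have -> : z `^ t = z * z `^ (t - 1).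
  by rewrite -{2}(powRr1 (ltW z0)) -powRD ?(gt_eqF z0) ?implybT // addrC subrK.
rewrite powRE.
apply: (@le_trans _ _ (z * (1 + (t - 1) * ln z))); last first.
  by rewrite ler_pM2l // expR_ge1Dx.
have h : 1 - z^-1 <= ln z.
  by have := lnle z^-1; rewrite invr_gt0 lnV ?posrE // => /(_ z0); lra.
apply: (@le_trans _ _ (z * (1 + (t - 1) * (1 - z^-1)))).
  have zV : z * z^-1 = 1 by rewrite mulfV ?gt_eqF.
  rewrite le_eqVlt; apply/orP; left; apply/eqP.
  have -> : z * (1 + (t - 1) * (1 - z^-1)) = z + (t - 1) * (z - z * z^-1) by ring.
  by rewrite zV; ring.
by rewrite ler_pM2l // lerD2l ler_wpM2l // subr_ge0.
Qed.

(** Integrating the tangent inequality for w / <w>_I and splitting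
    w^t = u^(-1/2) (u w^(2t))^(1/2) by Young's inequality gives
    <u^-1>_I <u w^(2t)>_I >= <w>_I^(2t). *)
Lemma joint_ge1 u w t I : (forall x, 0 < u x) -> (forall x, 0 < w x) ->
  t <= 0 \/ 1 <= t -> dloc w -> dloc (inv_weight u) -> dloc (mul_weight u w t) ->
  1 <= density_symbol w t I ^+ 2 * dint (inv_weight u) I *
       dint (mul_weight u w t) I.
Proof.
move=> u0 w0 ht wl nul vl.
have d0 := @dlen_gt0 R I.
have a0 := avg_gt0 I wl w0.
have r0 := symbol_gt0 t I wl w0.
pose a := fine (avg w I); pose r := symbol w t I.
have aE : dint w I = dlen I * a by rewrite /a avg_dint //= mulVKf ?gt_eqF.
have nu_gt0 x : 0 < inv_weight u x by rewrite invr_gt0.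
have v_gt0 x : 0 < mul_weight u w t x by rewrite mulr_gt0 ?powR_gt0.
have m0 := dint_gt0 I nul nu_gt0; have n0 := dint_gt0 I vl v_gt0.
suff : dlen I ^+ 2 <= dint (inv_weight u) I * (r ^+ 2 * dint (mul_weight u w t) I).
  move=> h; rewrite /density_symbol -/r.
  have -> : (r / dlen I) ^+ 2 * dint (inv_weight u) I * dint (mul_weight u w t) I =
    dint (inv_weight u) I * (r ^+ 2 * dint (mul_weight u w t) I) / dlen I ^+ 2.
    by field; rewrite gt_eqF.
  by rewrite ler_pdivlMr ?exprn_gt0 // mul1r.
apply: sqr_le_mul_quad; rewrite ?(ltW m0) ?(ltW d0) //; last first.
  by rewrite mulr_ge0 ?sqr_ge0 ?(ltW n0).
move=> s s0.
have <- : dint (fun x => 2 * (1 - t) + 2 * t / a * w x) I = 2 * dlen I.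
  rewrite /dint RintegralD; first last.
  - exact: rintegrableZ (measurable_ditv I) (wl I).
  - exact: dloc_cst.
  - exact: measurable_ditv.
  rewrite Rintegral_cst; last exact: measurable_ditv.
  rewrite [X in _ * fine X + _](mu_ditv I) /=.
  rewrite RintegralZl; [|exact: measurable_ditv|exact: wl].
  by rewrite -/(dint w I) aE; field; rewrite gt_eqF.
have dE : s * dint (inv_weight u) I + s^-1 * (r ^+ 2 * dint (mul_weight u w t) I)
    = dint (fun x => s * inv_weight u x + s^-1 * r ^+ 2 * mul_weight u w t x) I.
  rewrite [s^-1 * (_ * dint _ _)]mulrA {3}/dint RintegralD ?RintegralZl //;
    try exact: measurable_ditv.
  - exact: vl.
  - exact: nul.
  - exact: rintegrableZ (measurable_ditv I) (nul I).
  - exact: rintegrableZ (measurable_ditv I) (vl I).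
rewrite dE; apply: le_Rintegral; first exact: measurable_ditv.
- apply: rintegrableD; [exact: measurable_ditv|exact: dloc_cst|].
  exact: rintegrableZ (measurable_ditv I) (wl I).
- apply: rintegrableD; [exact: measurable_ditv| |].
    exact: rintegrableZ (measurable_ditv I) (nul I).
  exact: rintegrableZ (measurable_ditv I) (vl I).
move=> x _.
have za : 0 < w x / a by rewrite divr_gt0.
apply: (@le_trans _ _ (2 * (w x / a) `^ t)).
  have := powR_ge_tangent za ht.
  rewrite -(ler_pM2l (_ : 0 < 2)) // => /(le_trans _); apply.
  by rewrite le_eqVlt; apply/orP; left; apply/eqP; field; rewrite gt_eqF.
have -> : (w x / a) `^ t = w x `^ t * r.
  by rewrite powRM ?invr_ge0 ?(ltW (w0 x)) ?(ltW a0) // /r /symbol -powRN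
    -powR_inv1 ?(ltW a0) // -powRrM mulN1r.
rewrite /inv_weight /mul_weight mulrC mulrC [2 * t]mulrC powRrM powR_mulrn ?powR_ge0 //.
have b0 : 0 < w x `^ t by rewrite powR_gt0.
move: (w x `^ t) b0 (u x) (u0 x) => b b0 y y0.
have y1 : y * y^-1 = 1 by rewrite mulfV ?gt_eqF.
have s1 : s * s^-1 = 1 by rewrite mulfV ?gt_eqF.
rewrite -subr_ge0.
have -> : s * y^-1 + s^-1 * r ^+ 2 * (y * b ^+ 2) - 2 * (b * r) =
   s * y^-1 * (1 - s^-1 * r * b * y) ^+ 2.
  by field; rewrite !gt_eqF.
by rewrite mulr_ge0 ?sqr_ge0 // mulr_ge0 ?invr_ge0 ?ltW.
Qed.

End conditions.

Section conditions_finite.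
Context {R : realType}.
Local Notation mu := (@lebesgue_measure R).
Implicit Types (f g u w nu v : R -> R) (I J : dyadic) (t C : R).

Lemma carleson_summandE nu v w t J : dloc nu -> dloc v ->
  ((dlen J)%:E * `|delta nu J| ^+ 2 *
     (avg v J * ((fine (avg w J) `^ (2 * t))^-1)%:E))%E =
  (carleson_term (dint nu) (dint v) (density_symbol w t) J)%:E.
Proof.
move=> nul vl; rewrite delta_dint // avg_dint // symbol_sqr abse_EFin.
rewrite -EFin_expe -!EFinM real_normK ?num_real //; congr EFin.
rewrite /carleson_term /density_symbol.
by field; rewrite gt_eqF // dlen_gt0.
Qed.

Lemma joint_termE u w t I : dloc (inv_weight u) -> dloc (mul_weight u w t) ->
  (avg (inv_weight u) I * avg (mul_weight u w t) I *
    ((fine (avg w I) `^ (2 * t))^-1)%:E)%E =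
  (density_symbol w t I ^+ 2 * dint (inv_weight u) I *
       dint (mul_weight u w t) I)%:E.
Proof.
move=> nul vl; rewrite (avg_dint I nul) (avg_dint I vl) symbol_sqr -!EFinM.
congr EFin.
by rewrite /density_symbol; field; rewrite gt_eqF // dlen_gt0.
Qed.

Lemma carleson_boundP nu v w t C : dloc nu -> dloc v -> (forall x, 0 < v x) ->
  carleson_bound nu v w t C <->
  (forall I (F : {fset dyadic}), (forall J, J \in F -> @ditv R J `<=` ditv I) ->
    \sum_(J <- F) carleson_term (dint nu) (dint v) (density_symbol w t) J
      <= C * dint nu I :> R).
Proof.
move=> nul vl v0.
pose T := carleson_term (dint nu) (dint v) (density_symbol w t).
have T0 J : 0 <= T J by apply: carleson_term_ge0; exact: dint_gt0.
have E I : ((dlen I)^-1%:E * (\esum_(J in [set J | @ditv R J `<=` ditv I])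
      ((dlen J)%:E * `|delta nu J| ^+ 2 *
       (avg v J * ((fine (avg w J) `^ (2 * t))^-1)%:E))) <= C%:E * avg nu I)%E =
   (\esum_(J in [set J | @ditv R J `<=` ditv I]) (T J)%:E <= (C * dint nu I)%:E)%E.
  under eq_esum do rewrite carleson_summandE //.
  rewrite avg_dint // muleC -EFinM -lee_pdivlMr ?invr_gt0 ?dlen_gt0 //.
  by rewrite invrK -EFinM; congr (_ <= _%:E)%E; field; rewrite gt_eqF // dlen_gt0.
split=> [H I F FI|H I].
  have := H I; rewrite E => h.
  rewrite -lee_fin; apply: le_trans h.
  rewrite -sumEFin; apply: esum_ge; exists [set` F].
    by split => [|J /= JF]; [exact: finite_fset|exact: FI].
  by rewrite fsbig_finite ?set_fsetK //=; exact: finite_fset.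
rewrite E; apply: ge_ereal_sup => _ [X [finX XI] <-].
rewrite fsbig_finite //= sumEFin lee_fin; apply: H => J.
by rewrite in_fset_set // inE => /XI.
Qed.

Lemma carleson_bound_subtree nu v w t C : dloc nu -> dloc v ->
  (forall x, 0 < v x) -> carleson_bound nu v w t C ->
  forall k I, \sum_(J <- subtree k I)
    carleson_term (dint nu) (dint v) (density_symbol w t) J <= C * dint nu I :> R.
Proof.
move=> nul vl v0 /(carleson_boundP _ _ _ nul vl v0) H k I.
pose F : {fset dyadic} := seq_fset tt (subtree k I).
apply: le_trans (H I F _); last first.
  by move=> J; rewrite seq_fsetE => /subtree_sub.
rewrite (perm_big (enum_fset F)) //.
by rewrite perm_sym; apply: uniq_perm => [||J]; rewrite ?fset_uniq ?subtree_uniq ?seq_fsetE.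
Qed.

Lemma dloc_of_joint u w t : measurable_fun setT u -> measurable_fun setT w ->
  (forall x, 0 < u x) -> (forall x, 0 < w x) -> dloc w ->
  (joint_const u w t < +oo)%E ->
  dloc (inv_weight u) /\ dloc (mul_weight u w t).
Proof.
move=> mes_u mw u0 w0 wl joint.
have mi := measurable_inv_weight mes_u; have mv := measurable_mul_weight t mes_u mw.
have i0 x : 0 < inv_weight u x by rewrite invr_gt0.
have v0 x : 0 < mul_weight u w t x by rewrite mulr_gt0 // powR_gt0.
have meas (f : R -> R) I : measurable_fun setT f ->
  measurable_fun (ditv I : set (measurableTypeR R)) f by exact: measurable_funTS.
have pos f I : measurable_fun setT f -> (forall x, 0 < f x) -> (0 < avg f I)%E.
  move=> mf f0; rewrite /avg mule_gt0 ?lte_fin ?invr_gt0 ?dlen_gt0 //.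
  by apply: integral_ditv_gt0 => //; exact: meas.
have fin f I : measurable_fun setT f -> (forall x, 0 < f x) ->
    (avg f I < +oo)%E -> rintegrable (ditv I) f.
  move=> mf f0 foo; apply/integrableP; split.
    by apply/measurable_EFinP; exact: meas.
  under eq_integral do rewrite gee0_abs ?lee_fin ?(ltW (f0 _)) //.
  rewrite ltNge leye_eq; apply: contraTN foo => /eqP.
  by rewrite /avg => ->; rewrite gt0_muley ?ltxx // lte_fin invr_gt0 dlen_gt0.
have prod I : (avg (inv_weight u) I * avg (mul_weight u w t) I < +oo)%E.
  have : (avg (inv_weight u) I * avg (mul_weight u w t) I *
                 ((fine (avg w I) `^ (2 * t))^-1)%:E < +oo)%E.
    by apply: le_lt_trans joint; apply: ereal_sup_ubound; exists I.
  rewrite ![(_ < +oo)%E]ltNge !leye_eq; apply: contraNN => /eqP ->.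
  by rewrite gt0_mulye // lte_fin invr_gt0 powR_gt0 // avg_gt0.
have := pos _ _ mi i0; have := pos _ _ mv v0 => pv pi.
split=> I; apply: fin => //; have := prod I;
    rewrite ![(_ < +oo)%E]ltNge !leye_eq; apply: contraNN => /eqP ->.
  by rewrite gt0_mulye.
by rewrite gt0_muley.
Qed.

End conditions_finite.

(** * Square functions of f and the energy of a Haar sum *)

Section tree_energy.
Context {R : realType}.
Local Notation mu := (@lebesgue_measure R).
Implicit Types (f g k kap : R -> R) (I J : dyadic).

Lemma dint_ge0 k I : (forall x, 0 <= k x) -> 0 <= dint k I.
Proof. by move=> k0; apply: Rintegral_ge0. Qed.

Lemma dint_halflines_le k (N : nat) : rintegrable setT k -> (forall x, 0 <= k x) ->
  dint k (- N%:Z, 0) + dint k (- N%:Z, - 1) <= \int[mu]_x k x.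
Proof.
move=> ki k0; have kl := rintegrable_dloc ki.
rewrite -!Rintegral_indic -RintegralD //; try exact: rintegrable_indic.
apply: le_Rintegral => //.
  by apply: rintegrableD => //; exact: rintegrable_indic.
move=> x _; rewrite -mulrDr -[leRHS]mulr1 ler_wpM2l //.
have := @halflines_disjoint R N x; rewrite !indicE.
case: (boolP (x \in ditv (- N%:Z, 0))) => [/set_mem xr|_];
  case: (boolP (x \in ditv (- N%:Z, - 1))) => [/set_mem xl|_] D;
  rewrite ?addr0 ?add0r ?ler01 //.
by exfalso; exact: D.
Qed.

Variables (kap f : R -> R).
Hypotheses (kl : dloc kap) (k0 : forall x, 0 < kap x) (fl : dloc f).
Hypothesis fi : rintegrable setT (fun x => f x ^+ 2 / kap x).

Let X := dint (fun x => f x ^+ 2 / kap x).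

Let X0 x : 0 <= f x ^+ 2 / kap x.
Proof. by rewrite divr_ge0 ?sqr_ge0 // ltW. Qed.

Let XA : tree_additive X.
Proof. exact/dint_additive/rintegrable_dloc. Qed.

(** The Cauchy-Schwarz inequality, from (f - c kap)^2 / kap >= 0 with c the
    kap-average of f. *)
Lemma dint_sqr_le I : dint f I ^+ 2 / dint kap I <= X I.
Proof.
have m0 := dint_gt0 I kl k0.
have mI := @measurable_ditv R I.
pose c := dint f I / dint kap I.
have Xi := rintegrable_dloc fi I.
have fc : rintegrable (ditv I) (fun x => 2 * c * f x) := rintegrableZ (2 * c) mI (fl I).
have kc : rintegrable (ditv I) (fun x => c ^+ 2 * kap x) := rintegrableZ (c ^+ 2) mI (kl I).
have : 0 <= dint (fun x => f x ^+ 2 / kap x - 2 * c * f x + c ^+ 2 * kap x) I.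
  apply: dint_ge0 => x.
  have -> : f x ^+ 2 / kap x - 2 * c * f x + c ^+ 2 * kap x =
      (f x - c * kap x) ^+ 2 / kap x by field; rewrite gt_eqF.
  by rewrite divr_ge0 ?sqr_ge0 // ltW.
rewrite /dint RintegralD //; last exact: rintegrableB.
rewrite RintegralB // !RintegralZl //; [|exact: kl|exact: fl].
rewrite -/(dint f I) -/(dint kap I).
have XE : X I = \int[mu]_(x in ditv I) (f x ^+ 2 / kap x) by [].
rewrite -XE.
suff -> : dint f I ^+ 2 / dint kap I = 2 * c * dint f I - c ^+ 2 * dint kap I by lra.
by rewrite /c; field; rewrite gt_eqF.
Qed.

Lemma bessel_total (F : {fset dyadic}) :
  \sum_(J <- F) bessel (dint kap) (dint f) J <= \int[mu]_x (f x ^+ 2 / kap x) :> R.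
Proof.
have mA := dint_additive kl; have xA := dint_additive fl.
have m0 J : 0 < dint kap J by exact: dint_gt0.
rewrite -[leRHS]mul1r; apply: (sum_halflines_le (X := X)) => //.
- by move=> J; exact: bessel_ge0.
- by apply: bessel_sum_le => //; exact: dint_sqr_le.
- by move=> N; exact: dint_halflines_le.
Qed.

Lemma carleson_total (lam : dyadic -> R) (C : R) (F : {fset dyadic}) :
  (forall J, 0 <= lam J) -> 0 <= C ->
  (forall (k : nat) I, \sum_(J <- subtree k I) lam J <= C * dint kap I :> R) ->
  \sum_(J <- F) lam J * (dint f J / dint kap J) ^+ 2 <=
    4 * C * \int[mu]_x (f x ^+ 2 / kap x) :> R.
Proof.
move=> lam0 C0 lamC.
have mA := dint_additive kl; have xA := dint_additive fl.
have m0 J : 0 < dint kap J by exact: dint_gt0.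
apply: (sum_halflines_le (X := X)) => //.
- by move=> J; rewrite mulr_ge0 ?sqr_ge0.
- by apply: carleson_embedding => //; exact: dint_sqr_le.
- by rewrite mulr_ge0.
- by move=> N; exact: dint_halflines_le.
Qed.
End tree_energy.

Section haar_energy.
Context {R : realType}.
Local Notation mu := (@lebesgue_measure R).
Implicit Types (v : R -> R) (c : dyadic -> R) (s : seq dyadic).

Lemma rintegrable_energy v f : (forall x, 0 <= v x) -> measurable_fun setT v ->
  measurable_fun setT f -> (energy v f < +oo)%E ->
  rintegrable setT (fun x => f x ^+ 2 * v x).
Proof.
move=> v0 mv mf foo; apply/integrableP; split.
  by apply/measurable_EFinP/measurable_funM => //; exact: measurable_funX.
under eq_integral do rewrite gee0_abs ?lee_fin ?(mulr_ge0 (sqr_ge0 _) (v0 _)) //.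
exact: foo.
Qed.

Lemma dloc_hsum v c s : dloc v -> dloc (fun x => v x * hsum c s x).
Proof. by move=> vl; exact/rintegrable_dloc/rintegrable_hsum. Qed.

Lemma rintegrable_hsum_sqr v c s : dloc v ->
  rintegrable setT (fun x => hsum c s x ^+ 2 * v x).
Proof.
move=> vl; have -> : (fun x => hsum c s x ^+ 2 * v x) =
    (fun x => v x * hsum c s x * hsum c s x) by apply/funext => x; ring.
by apply: rintegrable_hsum; exact: dloc_hsum.
Qed.

Lemma energy_hsum v c s : dloc v ->
  energy v (hsum c s) = (\int[mu]_x (hsum c s x ^+ 2 * v x))%:E.
Proof.
by move=> vl; rewrite EFin_Rintegral //; exact: rintegrable_hsum_sqr.
Qed.

Lemma energy_hsumE v c s : dloc v ->
  energy v (hsum c s) =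
  (\sum_(J <- s) c J * haar_coef (fun x => v x * hsum c s x) J)%:E.
Proof.
move=> vl; rewrite energy_hsum // -Rintegral_hsum; last exact: dloc_hsum.
by congr EFin; apply: eq_Rintegral => x _; ring.
Qed.
End haar_energy.

(** * Nets of finite partial sums *)

Section finite_sums.
Context {R : realType}.
Implicit Types (f g u w : R -> R) (s : dyadic -> bool) (F : {fset dyadic}).

Lemma sum_fsetD (V : zmodType) (T : choiceType) (h : T -> V) (F0 F : {fset T}) :
  (F0 `<=` F)%fset -> \sum_(i <- F) h i =
    \sum_(i <- F0) h i + \sum_(i <- (F `\` F0)%fset) h i.
Proof.
move=> /fsubsetP F0F; rewrite -big_cat /=; apply: perm_big; apply: uniq_perm.
- exact: fset_uniq.
- rewrite cat_uniq !fset_uniq andbT /=; apply/hasPn => i.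
  by rewrite in_fsetD => /andP[].
move=> i; rewrite mem_cat in_fsetD.
by have := F0F i; case: (i \in F0) => //= ->.
Qed.

Lemma sum_tail_small (T : choiceType) (p : T -> R) (B e : R) :
  (forall i, 0 <= p i) -> (forall F : {fset T}, \sum_(i <- F) p i <= B) -> 0 < e ->
  exists F0 : {fset T}, forall F : {fset T}, (F0 `<=` F)%fset ->
    \sum_(i <- (F `\` F0)%fset) p i <= e.
Proof.
move=> p0 pB e0.
pose A := [set \sum_(i <- F) p i | F in [set: {fset T}]].
have supA : has_sup A.
  split; first by exists (\sum_(i <- fset0) p i), fset0.
  by exists B => _ [F _ <-].
have [_ [F0 _ <-] lt] := sup_adherent e0 supA.
exists F0 => F F0F.
have : \sum_(i <- F) p i <= sup A by apply: sup_upper_bound => //; exists F.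
by rewrite (sum_fsetD p F0F); lra.
Qed.

Lemma cvg_totally0 (T : choiceType) (h : {fset T} -> \bar R) :
  (forall F : {fset T}, 0 <= h F)%E ->
  (forall e : R, 0 < e -> exists F0 : {fset T}, forall F : {fset T},
     (F0 `<=` F)%fset -> (h F <= e%:E)%E) ->
  h F @[F --> (@totally T)] --> 0%E.
Proof.
move=> h0 he A [e /= e0 eA].
have [F0 F0P] := he _ (divr_gt0 e0 (ltr0Sn _ 1)).
exists F0 => // F /= F0F.
have := F0P F F0F; have := h0 F; case: (h F) => // r.
rewrite !lee_fin => r0 re; apply: eA; rewrite /ball_ /= sub0r normrN ger0_norm //.
by apply: le_lt_trans re _; rewrite ltr_pdivrMr // ltr_pMr // ltr1n.
Qed.

Lemma cvg_totally0_le (T : choiceType) (h : {fset T} -> \bar R) :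
  h F @[F --> (@totally T)] --> 0%E ->
  forall e : R, 0 < e -> exists F0 : {fset T}, forall F : {fset T},
     (F0 `<=` F)%fset -> (h F <= e%:E)%E.
Proof.
move=> h0 e e0.
have [|F0 _ F0P] := h0 [set y | (y <= e%:E)%E].
  exists e => //= r; rewrite /ball_ /= sub0r normrN => re.
  by rewrite lee_fin (le_trans (ler_norm r)) // ltW.
by exists F0 => F F0F; exact: F0P.
Qed.

(** The factor w^t common to all terms is taken out, to be squared later and
    absorbed into the target weight u w^(2t). *)
Lemma tHaar_sumE w t s f F x : (forall y, 0 < w y) ->
  tHaar_sum w t s f F x = w x `^ t *
    hsum (fun J => (-1) ^+ s J * symbol w t J * haar_coef f J) F x.
Proof.
move=> w0; rewrite /tHaar_sum /hsum mulr_sumr; apply: eq_bigr => J _.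
suff -> : (w x / fine (avg w J)) `^ t = w x `^ t * symbol w t J by ring.
have a0 : 0 <= fine (avg w J).
  rewrite fine_ge0 // /avg mule_ge0 ?lee_fin ?invr_ge0 ?(ltW (dlen_gt0 J)) //.
  by apply: integral_ge0 => y _; rewrite lee_fin ltW.
by rewrite powRM ?invr_ge0 ?(ltW (w0 x)) // /symbol -powRN -powR_inv1 // -powRrM mulN1r.
Qed.

Lemma energy_tHaar_sum u w t s f F : (forall y, 0 < w y) ->
  energy u (tHaar_sum w t s f F) = energy (mul_weight u w t)
    (hsum (fun J => (-1) ^+ s J * symbol w t J * haar_coef f J) F).
Proof.
move=> w0; apply: eq_integral => x _; rewrite tHaar_sumE // /mul_weight.
by rewrite [2 * t]mulrC powRrM powR_mulrn ?powR_ge0 //; congr EFin; ring.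
Qed.

Lemma measurable_tHaar_sum w t s f F : measurable_fun setT w ->
  measurable_fun setT (tHaar_sum w t s f F).
Proof.
move=> mw; apply: measurable_sum => J.
apply: measurable_funM; last exact: measurable_haar.
apply: measurable_funM => //; apply: measurable_funM => //.
apply: (measurableT_comp (measurable_powR _)).
exact: measurable_funM.
Qed.
End finite_sums.

(** * Sufficiency *)

Section upper_bound.
Context {R : realType}.
Local Notation mu := (@lebesgue_measure R).
Variables (u w : R -> R) (t C1 C2 C3 : R).
Hypotheses (mes_u : measurable_fun setT u) (mes_w : measurable_fun setT w).
Hypotheses (u0 : forall x, 0 < u x) (w0 : forall x, 0 < w x).
Hypotheses (ht : t <= 0 \/ 1 <= t) (wl : dloc w).
Let nu := inv_weight u.
Let v := mul_weight u w t.
Hypotheses (nul : dloc nu) (vl : dloc v).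
Let m := dint nu.
Let n := dint v.
Let rho := density_symbol w t.
Hypothesis joint : forall I, rho I ^+ 2 * m I * n I <= C1.
Hypotheses (C20 : 0 <= C2) (C30 : 0 <= C3).
Hypothesis carl : carleson_bound nu v w t C2.
Hypothesis dual_carl : carleson_bound v nu w t C3.

Let nu0 x : 0 < nu x. Proof. by rewrite invr_gt0. Qed.
Let v0 x : 0 < v x. Proof. by rewrite mulr_gt0 // powR_gt0. Qed.
Let m0 J : 0 < m J. Proof. exact: dint_gt0. Qed.
Let n0 J : 0 < n J. Proof. exact: dint_gt0. Qed.
Let rho0 J : 0 < rho J. Proof. exact: density_symbol_gt0. Qed.
Let mA : tree_additive m. Proof. exact: dint_additive. Qed.
Let nA : tree_additive n. Proof. exact: dint_additive. Qed.

Variable f : R -> R.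
Hypotheses (mes_f : measurable_fun setT f) (fl : dloc f).
Hypothesis f_fin : (energy u f < +oo)%E.
Let x := dint f.
Let Xtot := fine (energy u f).

Let f2i : rintegrable setT (fun y => f y ^+ 2 / nu y).
Proof.
have := rintegrable_energy (fun y => ltW (u0 y)) mes_u mes_f f_fin.
by under eq_fun do rewrite -[u _]invrK.
Qed.

Let XtotE : Xtot = \int[mu]_y (f y ^+ 2 / nu y).
Proof.
by congr fine; apply: eq_integral => y _; rewrite /nu /inv_weight invrK.
Qed.

Let bes F : R := \sum_(J <- F) bessel m x J.
Let car F : R := \sum_(J <- F) carleson_term m n rho J * (x J / m J) ^+ 2.

Let bes_le (F : {fset dyadic}) : bes F <= Xtot.
Proof. by rewrite XtotE; exact: bessel_total. Qed.

Let car_le (F : {fset dyadic}) : car F <= 4 * C2 * Xtot.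
Proof.
rewrite XtotE; apply: carleson_total => //.
  by move=> J; exact: carleson_term_ge0.
exact: carleson_bound_subtree.
Qed.

Let term_ge0 J : 0 <= carleson_term m n rho J * (x J / m J) ^+ 2.
Proof. by rewrite mulr_ge0 ?sqr_ge0 // carleson_term_ge0. Qed.

Let coef (sg : dyadic -> bool) J := (-1) ^+ sg J * symbol w t J * haar_coef f J.

(** The Haar sum tested against itself is a bilinear sum in f and g v, where g
    is the Haar sum.  As (g v)^2 / v = g^2 v, the Bessel and Carleson estimates
    on the side of v bring back the energy of g, one square root of which
    cancels. *)
Lemma haar_sum_energy_le sg (F : {fset dyadic}) :
  (energy v (hsum (coef sg) F) <=
   (((Num.sqrt C1 + Num.sqrt C3) * Num.sqrt (bes F) +
    2^-1 * (1 + Num.sqrt C3) * Num.sqrt (car F)) ^+ 2)%:E)%E.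
Proof.
set g := hsum _ _; pose gv y := v y * g y.
have gvl : dloc gv by exact: dloc_hsum.
have gi : rintegrable setT (fun y => gv y ^+ 2 / v y).
  have := rintegrable_hsum_sqr (coef sg) F vl.
  congr (rintegrable _ _); apply/funext => y; rewrite /gv -/g.
  by field; rewrite gt_eqF.
have EE : energy v g = (\int[mu]_y (gv y ^+ 2 / v y))%:E.
  rewrite energy_hsum //; congr EFin; apply: eq_Rintegral => y _.
  by rewrite /gv -/g; field; rewrite gt_eqF.
pose E := \int[mu]_y (gv y ^+ 2 / v y); rewrite EE -/E lee_fin.
have E0 : 0 <= E by apply: Rintegral_ge0 => y _; rewrite divr_ge0 ?sqr_ge0 // ltW.
pose y := dint gv.
have Ele : E <= \sum_(J <- F) rho J * `|x (dright J) - x (dleft J)| *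
    `|y (dright J) - y (dleft J)|.
  rewrite -lee_fin -EE energy_hsumE // lee_fin; apply: ler_sum => J _.
  apply: (le_trans (ler_norm _)).
  rewrite /coef !normrM normr_sign mul1r (haar_coefE J fl) (haar_coefE J gvl).
  rewrite !normrM -/x -/y -/gv (ger0_norm (ltW (symbol_gt0 t J wl w0))).
  have d0 := @dlen_gt0 R J.
  have s0 : 0 < Num.sqrt (dlen J) :> R by rewrite sqrtr_gt0.
  rewrite normfV (gtr0_norm s0) /rho /density_symbol.
  have := sqr_sqrtr (ltW d0); move: (Num.sqrt (dlen J)) s0 => q q0 <-.
  rewrite le_eqVlt; apply/orP; left; apply/eqP.
  by field; rewrite gt_eqF.
have r1 J : 1 <= rho J ^+ 2 * m J * n J by exact: joint_ge1.
have yA : tree_additive y by exact: dint_additive.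
have xA : tree_additive x by exact: dint_additive.
have := bilinear_sum_le F mA nA xA yA m0 n0 rho0 r1 joint.
rewrite /= -/(bes F) -/(car F) => /(le_trans Ele).
have Ble : \sum_(J <- F) bessel n y J <= E by exact: bessel_total.
have B'le : \sum_(J <- F) carleson_term n m rho J * (y J / n J) ^+ 2 <= 4 * C3 * E.
  apply: carleson_total => //; first by move=> J; exact: carleson_term_ge0.
  exact: carleson_bound_subtree.
have {}Ble := ler_wsqrtr Ble; have {B'le} := ler_wsqrtr B'le.
have -> : Num.sqrt (4 * C3 * E) = 2 * Num.sqrt C3 * Num.sqrt E.
  rewrite sqrtrM ?mulr_ge0 // sqrtrM // (_ : 4 = 2 ^+ 2) ?sqrtr_sqr ?ger0_norm //.
  by ring.
move: Ble; set B := Num.sqrt _; set B' := Num.sqrt (\sum_(_ <- _) _ * _).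
have := sqrtr_ge0 (bes F); have := sqrtr_ge0 (car F).
have := sqrtr_ge0 C1; have := sqrtr_ge0 C3; have e0 := sqrtr_ge0 E.
have := sqr_sqrtr E0.
move: e0; move: (Num.sqrt E) (Num.sqrt C1) (Num.sqrt C3) => e c1 c3.
move: (Num.sqrt (bes F)) (Num.sqrt (car F)) => a a' e0 <- c30 c10 a'0 a0 Ble B'le h.
have {}h : e ^+ 2 <= e * ((c1 + c3) * a + 2^-1 * (1 + c3) * a').
  apply: (le_trans h).
  have h1 : c1 * (a * B) <= c1 * (a * e) by rewrite ler_wpM2l // ler_wpM2l.
  have h2 : a * B' <= a * (2 * c3 * e) by rewrite ler_wpM2l.
  have h3 : a' * B <= a' * e by rewrite ler_wpM2l.
  have h4 : a' * B' <= a' * (2 * c3 * e) by rewrite ler_wpM2l.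
  lra.
move: e0; rewrite le_eqVlt => /predU1P[<-|e0]; first by rewrite expr0n /= sqr_ge0.
move: h; rewrite expr2 ler_pM2l // => h.
by rewrite ler_sqr ?nnegrE // ?(le_trans (ltW e0) h) // ltW.
Qed.

Let SS := Num.sqrt C1 + Num.sqrt C2 + Num.sqrt C3 + Num.sqrt (C2 * C3).

Lemma haar_sum_energy_total sg (F : {fset dyadic}) :
  (energy v (hsum (coef sg) F) <= (SS ^+ 2)%:E * energy u f)%E.
Proof.
have fE : energy u f = Xtot%:E.
  by rewrite /Xtot fineK // ge0_fin_numE // energy_ge0.
have X0 : 0 <= Xtot by rewrite -lee_fin -fE energy_ge0.
apply: le_trans (haar_sum_energy_le sg F) _; rewrite fE -EFinM lee_fin.
rewrite -{1}(sqr_sqrtr X0) -exprMn ler_sqr ?nnegrE; last 2 first.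
- by apply: addr_ge0; apply: mulr_ge0; rewrite ?sqrtr_ge0 // ?mulr_ge0 // addr_ge0 ?sqrtr_ge0.
- by rewrite mulr_ge0 ?sqrtr_ge0 // !addr_ge0 ?sqrtr_ge0.
have h := ler_wsqrtr (bes_le F); have := ler_wsqrtr (car_le F).
have -> : Num.sqrt (4 * C2 * Xtot) = 2 * Num.sqrt C2 * Num.sqrt Xtot.
  rewrite sqrtrM ?mulr_ge0 // sqrtrM // (_ : 4 = 2 ^+ 2) ?sqrtr_sqr ?ger0_norm //.
  by ring.
move=> h'; rewrite /SS sqrtrM //.
apply: (@le_trans _ _ ((Num.sqrt C1 + Num.sqrt C3) * Num.sqrt Xtot +
  2^-1 * (1 + Num.sqrt C3) * (2 * Num.sqrt C2 * Num.sqrt Xtot))).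
  by rewrite lerD // ler_wpM2l // ?mulr_ge0 ?addr_ge0 ?sqrtr_ge0.
by rewrite le_eqVlt; apply/orP; left; apply/eqP; field.
Qed.

Let D := 2 * (Num.sqrt C1 + Num.sqrt C3) ^+ 2 + 2 * (2^-1 * (1 + Num.sqrt C3)) ^+ 2.

Let D_ge0 : 0 <= D.
Proof. by rewrite addr_ge0 // mulr_ge0 ?sqr_ge0. Qed.

Lemma haar_sum_energy_le_summable sg (F : {fset dyadic}) :
  (energy v (hsum (coef sg) F) <=
   (D * \sum_(J <- F) (bessel m x J +
      carleson_term m n rho J * (x J / m J) ^+ 2))%:E)%E.
Proof.
apply: le_trans (haar_sum_energy_le sg F) _; rewrite lee_fin big_split /=.
have b0 : 0 <= bes F.
  by rewrite /bes sumr_ge0 // => J _; apply: bessel_ge0 => //; exact: dint_additive.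
have c0 : 0 <= car F by rewrite /car sumr_ge0.
rewrite -/(bes F) -/(car F) /D -{2}(sqr_sqrtr b0) -{2}(sqr_sqrtr c0).
move: (Num.sqrt (bes F)) (Num.sqrt (car F)) (_ + _ : R) (2^-1 * _) => a b p q.
rewrite -subr_ge0.
have -> : (2 * p ^+ 2 + 2 * q ^+ 2) * (a ^+ 2 + b ^+ 2) - (p * a + q * b) ^+ 2 =
  (p * a - q * b) ^+ 2 + 2 * (p * b) ^+ 2 + 2 * (q * a) ^+ 2 by ring.
by rewrite !addr_ge0 ?sqr_ge0 // mulr_ge0 ?sqr_ge0.
Qed.

(** The energy of a difference of two partial sums is controlled by the terms of
    a convergent series at the intervals where they differ, so the net is
    Cauchy. *)
Lemma tHaar_image_exists sg :
  exists2 g, tHaar_image u w t sg f g & (L2norm u g <= SS%:E * L2norm u f)%E.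
Proof.
pose p J := bessel m x J + carleson_term m n rho J * (x J / m J) ^+ 2.
have p0 J : 0 <= p J.
  by rewrite addr_ge0 //; apply: bessel_ge0 => //; exact: dint_additive.
have pB (F : {fset dyadic}) : \sum_(J <- F) p J <= Xtot + 4 * C2 * Xtot.
  by rewrite big_split lerD ?bes_le ?car_le.
have cauchy (e : R) : 0 < e -> exists F0 : {fset dyadic}, forall F : {fset dyadic},
    (F0 `<=` F)%fset ->
    (energy u (fun y => tHaar_sum w t sg f F y - tHaar_sum w t sg f F0 y)%R <= e%:E)%E.
  move=> e0.
  have eD : 0 < e / (D + 1) by rewrite divr_gt0 // ltr_wpDl.
  have [F0 F0P] := sum_tail_small p0 pB eD.
  exists F0 => F F0F.
  have -> : (fun y => tHaar_sum w t sg f F y - tHaar_sum w t sg f F0 y) =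
      tHaar_sum w t sg f (F `\` F0)%fset.
    by apply/funext => y; rewrite /tHaar_sum (sum_fsetD _ F0F) addrC addKr.
  rewrite (energy_tHaar_sum _ _ _ _ _ w0).
  apply: (le_trans (haar_sum_energy_le_summable sg _)); rewrite lee_fin -/p.
  apply: (@le_trans _ _ (D * (e / (D + 1)))).
    by rewrite ler_wpM2l //; exact: F0P.
  rewrite mulrCA ler_piMr ?(ltW e0) // ler_pdivrMr ?ltr_wpDl //.
  by rewrite mul1r lerDl.
have mT F : measurable_fun setT (tHaar_sum w t sg f F) by exact: measurable_tHaar_sum.
have [g [mg gcvg gbound]] := energy_complete mes_u u0 mT cauchy.
have fE : L2norm u f = sqrte (energy u f) := L2norm_energy u f.
have S0 : 0 <= SS by rewrite !addr_ge0 ?sqrtr_ge0.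
have gS : (L2norm u g <= SS%:E * L2norm u f)%E.
  rewrite !L2norm_energy -{1}(ger0_norm S0) -sqrtr_sqr -[(Num.sqrt _)%:E]/(sqrte (SS ^+ 2)%:E).
  rewrite -sqrteM ?lee_fin ?sqr_ge0 // lee_sqrt; last first.
    by rewrite mule_ge0 ?lee_fin ?sqr_ge0 // energy_ge0.
  apply: gbound => F; rewrite (energy_tHaar_sum _ _ _ _ _ w0).
  exact: haar_sum_energy_total.
exists g => //; split.
  split => //; apply: (le_lt_trans gS).
  rewrite lte_mul_pinfty ?lee_fin // fE.
  by rewrite -ge0_fin_numE ?sqrte_ge0 // sqrte_fin_num ?energy_ge0 // ge0_fin_numE
    ?energy_ge0.
apply: cvg_totally0 => [F|e e0]; first exact: sqrte_ge0.
have [F0 F0P] := gcvg (e ^+ 2) (exprn_gt0 2 e0).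
exists F0 => F F0F; rewrite L2norm_energy.
rewrite -(ger0_norm (ltW e0)) -sqrtr_sqr -[(Num.sqrt _)%:E]/(sqrte (e ^+ 2)%:E).
by rewrite lee_sqrt ?lee_fin ?sqr_ge0 //; exact: F0P.
Qed.

End upper_bound.

(** * Necessity: testing the multipliers *)

Section signs.
Context {R : realType}.
Local Notation mu := (@lebesgue_measure R).
Implicit Types (kap : R -> R) (c : dyadic -> R) (F : seq dyadic).

Lemma energy_haar kap I : (forall x, 0 <= kap x) -> measurable_fun setT kap ->
  energy kap (haar I) = avg kap I.
Proof.
move=> k0 mk; rewrite /energy /avg.
under eq_integral do rewrite haar_sqr -mulrA EFinM.
rewrite ge0_integralZl //; last 3 first.
- apply/measurable_EFinP/measurable_funM => //.
  exact: measurable_indic (measurable_ditv _).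
- by move=> x _; rewrite lee_fin mulr_ge0 // indicE.
- by rewrite lee_fin invr_ge0 ltW // dlen_gt0.
congr (_ * _)%E; rewrite [RHS]integral_mkcond; apply: eq_integral => x _.
by rewrite /patch indicE; case: (x \in _); rewrite ?mul1r ?mul0r.
Qed.

(** Signs can be chosen greedily, one interval at a time: by the parallelogram
    law one of y + x and y - x has at least the energy of y plus that of x. *)
Lemma exists_signs kap c F : (forall x, 0 < kap x) -> measurable_fun setT kap ->
  uniq F -> exists sg : dyadic -> bool,
  (\sum_(J <- F) (c J ^+ 2)%:E * avg kap J <=
    energy kap (hsum (fun J => (-1) ^+ sg J * c J)%R F))%E.
Proof.
move=> k0 mk; elim: F => [_|J F IH /= /andP[JF uF]].
  by exists (fun=> false); rewrite big_nil; exact: energy_ge0.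
have [sg hsg] := IH uF.
pose y := hsum (fun K => (-1) ^+ sg K * c K) F.
pose z x := c J * haar J x.
have my : measurable_fun setT y by exact: measurable_hsum.
have mz : measurable_fun setT z.
  by apply: measurable_funM => //; exact: measurable_haar.
have ez : energy kap z = ((c J ^+ 2)%:E * avg kap J)%E.
  by rewrite energyZ ?energy_haar //; [move=> x; exact: ltW|exact: measurable_haar].
have par := energy_parallelogram mk k0 my mz.
have ext b : hsum (fun K => (-1) ^+ (if K == J then b else sg K) * c K) (J :: F) =
    (fun x => y x + (-1) ^+ b * z x).
  apply/funext => x; rewrite /hsum big_cons eqxx addrC /y /z /hsum.
  congr (_ + _); last by rewrite -!mulrA.
  rewrite !big_seq; apply: eq_bigr => K KF.
  by case: eqP => // KJ; move: JF; rewrite -KJ KF.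
have [le|lt] := leP (energy kap z + energy kap y)%E (energy kap (fun x => y x + z x)%R).
  exists (fun K => if K == J then false else sg K); rewrite ext big_cons -ez.
  apply: (le_trans (leeD (lexx _) hsg)); apply: (le_trans le).
  by under [in leRHS]eq_fun do rewrite expr0 mul1r.
exists (fun K => if K == J then true else sg K); rewrite ext big_cons -ez.
apply: (le_trans (leeD (lexx _) hsg)).
under [in leRHS]eq_fun do rewrite expr1 mulN1r.
rewrite leNgt; apply/negP => lt2.
have := lteD lt lt2; rewrite par -/y.
have -> : (2%:E * energy kap y + 2%:E * energy kap z =
   energy kap z + energy kap y + (energy kap z + energy kap y))%E.
  by rewrite !mule_natl !mule2n addeACA addeC [in RHS]addeC [energy kap z + _]addeC.
by rewrite ltxx.
Qed.
End signs.

Section test_functions.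
Context {R : realType}.
Implicit Types (g kap : R -> R) (I J : dyadic).

Lemma haar_coef_indic g I J : dloc g -> @ditv R J `<=` ditv I ->
  haar_coef (fun x => g x * \1_(ditv I) x) J = haar_coef g J.
Proof.
move=> gl JI.
have dE K : @ditv R K `<=` ditv J -> dint (fun x => g x * \1_(ditv I) x) K = dint g K.
  move=> KJ; apply: eq_Rintegral => x /set_mem /KJ /JI xI.
  by rewrite indicE mem_set // mulr1.
rewrite !haar_coefE //; last exact/rintegrable_dloc/rintegrable_indic.
by rewrite !dE // => x xJ; apply/ditv_child; [left|right].
Qed.

Lemma haar_square_carleson w t g kap J : dloc g ->
  (symbol w t J * haar_coef g J) ^+ 2 * ((dlen J)^-1 * dint kap J) =
  4^-1 * carleson_term (dint g) (dint kap) (density_symbol w t) J.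
Proof.
move=> gl; rewrite haar_coefE // /carleson_term /density_symbol.
have d0 := @dlen_gt0 R J.
have s0 : 0 < Num.sqrt (dlen J) :> R by rewrite sqrtr_gt0.
have := sqr_sqrtr (ltW d0); move: (Num.sqrt (dlen J)) s0 => q q0 <-.
by field; rewrite gt_eqF.
Qed.

(** By nestedness, a dyadic interval other than I and not longer than I lies in
    one half of I or misses I. *)
Lemma haar_const I J : I != J -> I.1 <= J.1 ->
  exists c : R, forall x, ditv J x -> haar I x = c.
Proof.
case: I J => [i k] [j l] /= IJ ij.
have [d] : exists d : nat, j = i + d%:Z by exists (absz (j - i)); lia.
case: d => [|d] jE.
  have lk : l != k by apply: contraNneq IJ => ->; rewrite jE addr0.
  exists 0 => x xJ.
  have xI : ~ ditv (i, k) x.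
    rewrite jE in xJ; move/(ditv_descendant k xJ); rewrite expn0; lia.
  have xl : ~ ditv (dleft (i, k)) x by move=> ?; apply/xI/ditv_child; left.
  have xr : ~ ditv (dright (i, k)) x by move=> ?; apply/xI/ditv_child; right.
  by rewrite /haar !indicE !memNset // subrr mulr0.
have jE' : j = (i + 1) + d%:Z by lia.
rewrite jE' in IJ ij *.
have const (k' : int) : exists b : bool, forall x : R, ditv (i + 1 + d%:Z, l) x ->
    (x \in (ditv (i + 1, k') : set R)) = b.
  pose b := ((2 ^ d)%N%:Z * k' <= l) && (l < (2 ^ d)%N%:Z * (k' + 1)).
  exists b => x xJ; apply/idP/idP => [/set_mem/(ditv_descendant k' xJ)[h1 h2]|].
    by apply/andP.
  by move=> /andP[h1 h2]; apply/mem_set/(ditv_descendant k' xJ).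
have [bl hl] := const (2 * k); have [br hr] := const (2 * k + 1).
exists ((Num.sqrt (dlen (i, k)))^-1 * (br%:R - bl%:R)) => x xJ.
by rewrite /haar !indicE hl // hr.
Qed.

Lemma dloc_haar I : dloc (@haar R I).
Proof.
apply: rintegrable_dloc; have := rintegrable_haar I (@dloc_cst R 1).
by under eq_fun do rewrite mul1r.
Qed.

Lemma haar_orthogonal I J : I != J -> haar_coef (@haar R I) J = 0.
Proof.
wlog le : I J / I.1 <= J.1 => [H IJ|IJ].
  have [|/ltW le] := leP I.1 J.1; first by move=> le; exact: H.
  rewrite eq_sym in IJ; rewrite -(H J I le IJ) /haar_coef.
  by apply: eq_Rintegral => x _; rewrite mulrC.
have [c hc] := haar_const IJ le.
rewrite haar_coefE; last exact: dloc_haar.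
have dE K : @ditv R K `<=` ditv J -> dint (haar I) K = c * dlen K.
  move=> KJ; rewrite -[dlen K]/(fine (dlen K)%:E) -mu_ditv.
  rewrite -Rintegral_cst; last exact: measurable_ditv.
  by apply: eq_Rintegral => x /set_mem /KJ /hc.
rewrite !dE; first by rewrite /dlen /= subrr mulr0.
- by move=> x xJ; apply/ditv_child; left.
- by move=> x xJ; apply/ditv_child; right.
Qed.

Lemma haar_normalized I : haar_coef (@haar R I) I = 1.
Proof.
rewrite /haar_coef; under eq_Rintegral do rewrite -expr2 haar_sqr.
rewrite RintegralZl //; last first.
  have := rintegrable_indic I (@dloc_cst R 1).
  by under eq_fun do rewrite mul1r.
have -> : \int[lebesgue_measure]_x \1_(ditv I) x = dlen I :> R.
  transitivity (dint (fun=> 1 : R) I).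
    by rewrite -Rintegral_indic; apply: eq_Rintegral => x _; rewrite mul1r.
  rewrite /dint Rintegral_cst; last exact: measurable_ditv.
  by rewrite [X in fine X](mu_ditv I) mul1r.
by rewrite mulVf // gt_eqF // dlen_gt0.
Qed.
End test_functions.

Section lower_bound.
Context {R : realType}.
Local Notation mu := (@lebesgue_measure R).
Variables (u w : R -> R) (t : R).
Hypotheses (mes_u : measurable_fun setT u) (mes_w : measurable_fun setT w).
Hypotheses (u0 : forall x, 0 < u x) (w0 : forall x, 0 < w x).
Hypothesis (wl : dloc w).
Let nu := inv_weight u.
Let v := mul_weight u w t.

Let mes_nu : measurable_fun setT nu. Proof. exact: measurable_inv_weight. Qed.
Let mes_v : measurable_fun setT v. Proof. exact: measurable_mul_weight. Qed.

Let nu0 x : 0 < nu x. Proof. by rewrite invr_gt0. Qed.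
Let v0 x : 0 < v x. Proof. by rewrite mulr_gt0 // powR_gt0. Qed.

Lemma rintegrable_locally (f : R -> R) : rintegrable setT f ->
  locally_integrable setT f.
Proof. by move=> fi; apply: open_integrable_locally => //; exact: openT. Qed.

Lemma L2norm_le_energy f g (c : R) : 0 <= c ->
  (L2norm u g <= c%:E * L2norm u f)%E ->
  (energy u g <= (c ^+ 2)%:E * energy u f)%E.
Proof.
move=> c0; rewrite !L2norm_energy -{1}(ger0_norm c0) -sqrtr_sqr.
rewrite -[(Num.sqrt _)%:E]/(sqrte (c ^+ 2)%:E) -sqrteM ?lee_fin ?sqr_ge0 //.
by rewrite lee_sqrt // mule_ge0 ?lee_fin ?sqr_ge0 // energy_ge0.
Qed.

Lemma tHaar_image_near s f g (e : R) : tHaar_image u w t s f g -> 0 < e ->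
  exists F0 : {fset dyadic}, forall F : {fset dyadic}, (F0 `<=` F)%fset ->
  (energy u (fun x => tHaar_sum w t s f F x - g x)%R <= e%:E)%E.
Proof.
move=> [_ /cvg_totally0_le cv] e0.
have [F0 F0P] := cv (Num.sqrt e) (etrans (sqrtr_gt0 e) e0).
exists F0 => F /F0P; rewrite L2norm_energy -[(Num.sqrt e)%:E]/(sqrte e%:E).
by rewrite lee_sqrt // lee_fin ltW.
Qed.

Lemma energy_partial_le s f g (e : R) : tHaar_image u w t s f g -> 0 < e ->
  exists F0 : {fset dyadic}, forall F : {fset dyadic}, (F0 `<=` F)%fset ->
  (energy u (tHaar_sum w t s f F) <= 2%:E * e%:E + 2%:E * energy u g)%E.
Proof.
move=> im e0; have [F0 F0P] := tHaar_image_near im e0.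
have mg : measurable_fun setT g by case: im => -[].
exists F0 => F /F0P le.
have mT := @measurable_tHaar_sum R w t s f F mes_w.
have -> : tHaar_sum w t s f F =
    (fun x => (tHaar_sum w t s f F x - g x) + g x).
  by apply/funext => x; rewrite subrK.
apply: (le_trans (energyD_le mes_u u0 _ mg)); first exact: measurable_funB.
by rewrite leeD2r // lee_wpmul2l.
Qed.

Lemma inL2_of_energy f : measurable_fun setT f -> (energy u f < +oo)%E -> inL2 u f.
Proof.
move=> mf foo; split => //; rewrite L2norm_energy.
by rewrite -ge0_fin_numE ?sqrte_ge0 // sqrte_fin_num ?energy_ge0 // ge0_fin_numE
  ?energy_ge0.
Qed.

(** By orthogonality of the Haar functions, every multiplier maps h_I to plus or
    minus (w / <w>_I)^t h_I, whose norm does not depend on the signs. *)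
Lemma tHaar_norm_gt0 : dloc u -> dloc v -> exists2 del : R, 0 < del &
  forall s c, 0 <= c -> tHaar_bounded_by u w t s c -> del <= c.
Proof.
move=> ul vl; pose I : dyadic := (0, 0).
have A0 : 0 < symbol w t I ^+ 2 * fine (avg v I).
  by rewrite mulr_gt0 ?exprn_gt0 ?symbol_gt0 ?avg_gt0.
have B0 : 0 < fine (avg u I) by exact: avg_gt0.
have uE : energy u (haar I) = (fine (avg u I))%:E.
  by rewrite energy_haar // ?avg_dint // => x; exact: ltW.
have vE : energy v (haar I) = (fine (avg v I))%:E.
  by rewrite energy_haar // ?avg_dint // => x; exact: ltW.
have hi : rintegrable setT (@haar R I).
  have := rintegrable_haar I (@dloc_cst R 1).
  by under eq_fun do rewrite mul1r.
exists (Num.sqrt (symbol w t I ^+ 2 * fine (avg v I) / (2 * fine (avg u I)))).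
  by rewrite sqrtr_gt0 divr_gt0 // mulr_gt0.
move=> s c c0 bnd.
have f2 : inL2 u (haar I).
  by apply: inL2_of_energy; [exact: measurable_haar|rewrite uE ltry].
have [g im /(L2norm_le_energy c0)] := bnd _ f2 (rintegrable_locally hi).
rewrite uE -EFinM => ge.
rewrite -(ger0_norm c0) -sqrtr_sqr ler_wsqrtr // ler_pdivrMr ?mulr_gt0 //.
rewrite -lee_fin; apply/lee_addgt0Pr => e e0.
have e2 : 0 < e / 2 by rewrite divr_gt0.
have [F0 F0P] := energy_partial_le im e2.
have := F0P (I |` F0)%fset (fsubsetUr _ _).
rewrite (energy_tHaar_sum _ _ _ _ _ w0) -/v.
have -> : hsum (fun J => (-1) ^+ s J * symbol w t J * haar_coef (haar I) J) (I |` F0)%fset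
    = (fun x => ((-1) ^+ s I * symbol w t I) * haar I x).
  apply/funext => x; rewrite /hsum (bigD1_seq I) ?fset_uniq ?fset1U1 //=.
  rewrite haar_normalized mulr1 big1 ?addr0 // => J JI.
  by rewrite haar_orthogonal 1?eq_sym // mulr0 mul0r.
rewrite energyZ ?vE; [|by []|by []|exact: measurable_haar].
rewrite -EFinM exprMn sqrr_sign mul1r => h.
apply: (le_trans h); apply: (@le_trans _ _ (2%:E * (e / 2)%:E +
   2%:E * (c ^+ 2 * fine (avg u I))%:E)%E).
  by rewrite leeD2l // lee_wpmul2l.
by rewrite -!(EFinM, EFinD) lee_fin; lra.
Qed.

Variable C : R.
Hypotheses (C0 : 0 < C) (Cbound : forall s, tHaar_bounded_by u w t s C).

(** Adding the multiplier and the one whose signs are flipped off F leaves twice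
    the partial sum over F.  Energies being squares, each of the two additions
    made on the way costs a factor 2. *)
Lemma partial_sum_bound s f (F : {fset dyadic}) : inL2 u f ->
  locally_integrable setT f ->
  (energy u (tHaar_sum w t s f F) <= (2 * C ^+ 2)%:E * energy u f)%E.
Proof.
move=> f2 fl; pose s' J := if J \in F then s J else ~~ s J.
have [g im /(L2norm_le_energy (ltW C0)) ge] := Cbound s f2 fl.
have [g' im' /(L2norm_le_energy (ltW C0)) ge'] := Cbound s' f2 fl.
have mT s1 F1 := @measurable_tHaar_sum R w t s1 f F1 mes_w.
have fin : energy u f \is a fin_num.
  have [_] := f2; rewrite L2norm_energy => lt.
  by rewrite -sqrte_fin_num ?energy_ge0 // ge0_fin_numE // sqrte_ge0.
rewrite -(fineK fin) -EFinM in ge ge' *.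
move: (fine _) ge ge' => E ge ge'.
apply/lee_addgt0Pr => e e0.
have e2 : 0 < e / 2 by rewrite divr_gt0.
have [F1 F1P] := energy_partial_le im e2.
have [F2 F2P] := energy_partial_le im' e2.
pose G := (F `|` (F1 `|` F2))%fset.
have FG : (F `<=` G)%fset by exact: fsubsetUl.
have {}F1P := F1P G (fsubset_trans (fsubsetUl F1 F2) (fsubsetUr F _)).
have {}F2P := F2P G (fsubset_trans (fsubsetUr F1 F2) (fsubsetUr F _)).
have twice : (fun x => tHaar_sum w t s f G x + tHaar_sum w t s' f G x) =
    (fun x => 2 * tHaar_sum w t s f F x).
  apply/funext => x; rewrite /tHaar_sum !(sum_fsetD _ FG) addrACA -!big_split /=.
  rewrite [X in _ + X]big1_seq ?addr0 => [|J]; last first.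
    rewrite in_fsetD /s' => /andP[_ /andP[/negbTE -> _]].
    by case: (s J) => /=; ring.
  rewrite mulr_sumr !big_seq; apply: eq_bigr => J JF.
  by rewrite /s' JF; ring.
have := energyD_le mes_u u0 (mT s G) (mT s' G).
rewrite twice energyZ // => h.
have : ((2 ^+ 2)%:E * energy u (tHaar_sum w t s f F) <=
    (4 * (2 * C ^+ 2 * E + e))%:E)%E.
  apply: (le_trans h).
  apply: (@le_trans _ _ (2%:E * (2%:E * (e / 2)%:E + 2%:E * (C ^+ 2 * E)%:E) +
     2%:E * (2%:E * (e / 2)%:E + 2%:E * (C ^+ 2 * E)%:E))%E).
    apply: leeD; apply: lee_wpmul2l => //.
      by apply: (le_trans F1P); rewrite leeD2l // lee_wpmul2l.
    by apply: (le_trans F2P); rewrite leeD2l // lee_wpmul2l.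
  by rewrite -!(EFinM, EFinD) lee_fin; lra.
rewrite -EFinD -lee_pdivlMl // -EFinM; move/le_trans; apply.
by rewrite lee_fin; lra.
Qed.

(** As the bound is uniform in the signs, it holds for signs that make the energy
    of the partial sum at least the sum of the energies of its terms. *)
Lemma square_sum_bound f (F : {fset dyadic}) : inL2 u f ->
  locally_integrable setT f ->
  (\sum_(J <- F) ((symbol w t J * haar_coef f J) ^+ 2)%:E * avg v J <=
   (2 * C ^+ 2)%:E * energy u f)%E.
Proof.
move=> f2 fl.
have [s hs] := exists_signs (fun J => symbol w t J * haar_coef f J) v0
  mes_v (fset_uniq F).
apply: (le_trans hs); apply: le_trans (partial_sum_bound s F f2 fl).
rewrite (energy_tHaar_sum _ _ _ _ _ w0).
rewrite le_eqVlt; apply/orP; left; apply/eqP; congr (energy _ (hsum _ _)).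
by apply/funext => J; rewrite mulrA.
Qed.

(** Test function: u^-1 h_I, cut off where u^-1 is large because u^-1 is not
    yet known to be locally integrable. *)
Lemma joint_truncated I (N : R) : 0 < N ->
  ((symbol w t I ^+ 2)%:E * avg (fun x => Num.min (nu x) N) I * avg v I
    <= (2 * C ^+ 2)%:E)%E.
Proof.
move=> N0; pose cut x := Num.min (nu x) N; rewrite -/cut.
have mcut : measurable_fun setT cut by exact: measurable_minr.
have cut0 x : 0 < cut x by rewrite lt_min nu0 N0.
have cutl : dloc cut.
  move=> J; apply: (rintegrable_le (measurable_ditv J) _ _ (@dloc_cst R N J)).
    exact: measurable_funTS.
  by move=> x _; rewrite ger0_norm ?(ltW (cut0 x)) // ge_min lexx orbT.
have a0 : 0 < fine (avg cut I) by exact: avg_gt0.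
have aE : avg cut I = (fine (avg cut I))%:E by rewrite avg_dint.
pose f x := cut x * haar I x.
have fi : rintegrable setT f by exact: rintegrable_haar.
have mf : measurable_fun setT f by exact: rintegrable_measurable fi.
have coefE : haar_coef f I = fine (avg cut I).
  rewrite -(energy_haar I (fun x => ltW (cut0 x)) mcut); congr fine.
  by apply: eq_integral => x _; rewrite /f; congr EFin; ring.
have ef : (energy u f <= avg cut I)%E.
  rewrite -(energy_haar I (fun x => ltW (cut0 x)) mcut).
  apply: ge0_le_integral => //.
  - by move=> x _; rewrite lee_fin mulr_ge0 ?sqr_ge0 // ltW.
  - by apply/measurable_EFinP/measurable_funM => //; exact: measurable_funX.
  - apply/measurable_EFinP/measurable_funM => //.
    by apply: measurable_funX; exact: measurable_haar.
  move=> x _; rewrite lee_fin /f exprMn [_ * haar I x ^+ 2]mulrC -mulrA.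
  rewrite ler_wpM2l ?sqr_ge0 // expr2 -mulrA ler_piMr ?(ltW (cut0 x)) //.
  apply: (@le_trans _ _ (nu x * u x)).
    by rewrite ler_wpM2r ?(ltW (u0 x)) // /cut ge_min lexx.
  by rewrite /nu /inv_weight mulVf // gt_eqF.
have f2 : inL2 u f by apply: inL2_of_energy => //; rewrite (le_lt_trans ef) // aE ltry.
have := square_sum_bound [fset I]%fset f2 (rintegrable_locally fi).
rewrite big_seq_fset1 coefE => h.
have {h} : (((symbol w t I * fine (avg cut I)) ^+ 2)%:E * avg v I <=
    (2 * C ^+ 2)%:E * avg cut I)%E.
  by apply: (le_trans h); rewrite lee_wpmul2l // lee_fin mulr_ge0 ?sqr_ge0.
rewrite {2 3}aE; move: (fine _) a0 => a a0.
have -> : ((symbol w t I * a) ^+ 2)%:E = (a%:E * (symbol w t I ^+ 2 * a)%:E)%E.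
  by rewrite -EFinM; congr EFin; ring.
by rewrite -muleA [leRHS]muleC lee_pmul2l // EFinM.
Qed.

Lemma joint_const_le : (joint_const u w t <= (2 * C ^+ 2)%:E)%E.
Proof.
apply: ge_ereal_sup => _ [I _ <-]; rewrite symbol_sqr -/nu -/v.
have r0 : 0 < symbol w t I ^+ 2 by rewrite exprn_gt0 // symbol_gt0.
have mI := @measurable_ditv R I; have d0 := @dlen_gt0 R I.
pose cut (k : nat) x := Num.min (nu x) k.+1%:R.
have cut0 k x : 0 < cut k x by rewrite lt_min nu0 ltr0n.
have mcut k : measurable_fun setT (cut k) by exact: measurable_minr.
have pos (f : R -> R) : measurable_fun setT f -> (forall x, 0 < f x) ->
    (0 < avg f I)%E.
  move=> mf f0; rewrite /avg mule_gt0 ?lte_fin ?invr_gt0 //.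
  by apply: integral_ditv_gt0 => //; exact: measurable_funTS.
have bound k : ((symbol w t I ^+ 2)%:E * avg (cut k) I * avg v I
    <= (2 * C ^+ 2)%:E)%E by exact: joint_truncated.
have := pos v mes_v v0; case avE : (avg v I) => [a| |] //; last first.
  move=> _; have := bound 0%N; rewrite avE gt0_muley ?leye_eq //.
  by rewrite mule_gt0 ?lte_fin ?pos.
rewrite lte_fin => a0.
have ar : 0 < a * symbol w t I ^+ 2 by exact: mulr_gt0.
rewrite -muleA -EFinM muleC -lee_pdivlMl // -EFinM /avg.
rewrite muleC -lee_pdivlMr ?invr_gt0 // invrK -EFinM.
set b := (X in (_ <= X%:E)%E).
have bk k : (\int[mu]_(x in ditv I) (cut k x)%:E <= b%:E)%E.
  have := bound k; rewrite avE [(_ * avg _ _)%E]muleC -muleA -EFinM muleC.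
  rewrite [_ * a]mulrC -lee_pdivlMl // -EFinM /avg.
  by rewrite muleC -lee_pdivlMr ?invr_gt0 // invrK -EFinM.
have ce0 k x : (0 <= (cut k x)%:E)%E by rewrite lee_fin ltW.
have -> : (\int[mu]_(x in ditv I) (nu x)%:E =
    \int[mu]_(x in ditv I) limn_einf (fun k => (cut k x)%:E))%E.
  apply: eq_integral => x _; apply/esym; apply: (cvg_limn_einf_sup _).1.
  apply: cvg_EFin; first by near=> n.
  apply: cvg_near_cst; near=> k; rewrite /cut; apply/min_idPl.
  apply: (@le_trans _ _ k%:R); last by rewrite ler_nat.
  by near: k; exact: nbhs_infty_ger.
apply: le_trans (fatou mu mI _ _) _ => //.
  by move=> k; apply/measurable_EFinP; apply: measurable_funTS; exact: mcut.
rewrite limn_einf_lim; apply: lime_le; first exact: is_cvg_einfs.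
by near=> k; apply: le_trans (bk k); apply: ereal_inf_lbound; exists k => /=.
Unshelve. all: by end_near. Qed.

(** Test function: u^-1 1_I, which has the same Haar coefficients as u^-1 at all
    the subintervals of I. *)
Lemma carleson_bound_of_bounded : dloc nu -> dloc v ->
  carleson_bound nu v w t (8 * C ^+ 2).
Proof.
move=> nul vl; apply/(carleson_boundP _ _ _ nul vl v0) => I F FI.
pose f x := nu x * \1_(ditv I) x.
have fi : rintegrable setT f by exact: rintegrable_indic.
have ef : energy u f = (dint nu I)%:E.
  rewrite -Rintegral_indic EFin_Rintegral //; apply: eq_integral => x _.
  rewrite /f indicE; congr EFin; case: (x \in _); rewrite ?mulr0 ?mulr1 ?expr0n ?mul0r //.
  by rewrite expr2 -mulrA /nu /inv_weight mulVf ?mulr1 // gt_eqF.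
have f2 : inL2 u f.
  apply: inL2_of_energy; first exact: rintegrable_measurable fi.
  by rewrite ef ltry.
have := square_sum_bound F f2 (rintegrable_locally fi).
rewrite ef -EFinM.
have -> : (\sum_(J <- F) ((symbol w t J * haar_coef f J) ^+ 2)%:E * avg v J)%E =
    (4^-1 * \sum_(J <- F)
      carleson_term (dint nu) (dint v) (density_symbol w t) J)%:E.
  rewrite mulr_sumr -sumEFin !big_seq; apply: eq_bigr => J /FI JI.
  rewrite avg_dint // -EFinM haar_coef_indic //; congr EFin.
  exact: haar_square_carleson.
by rewrite lee_fin; lra.
Qed.

(** The adjoint applied to 1_I.  If g is the resulting Haar sum and f = u^-1 g,
    then the energy A of g is both that of f and the pairing of 1_I with the
    multiplier of f in L^2(v), which is at most A / 2 + C^2 int_I v. *)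
Lemma dual_haar_energy_le (sg : dyadic -> bool) I (F : {fset dyadic}) : dloc nu -> dloc v ->
  (energy nu (hsum (fun J => (-1) ^+ sg J *
      (symbol w t J * haar_coef (fun x => v x * \1_(ditv I) x) J))%R F)
   <= (2 * C ^+ 2 * dint v I)%:E)%E.
Proof.
move=> nul vl; set d := fun J => _; set g := hsum _ _.
pose psi x := v x * \1_(ditv I) x.
have psii : rintegrable setT psi by exact: rintegrable_indic.
have psil : dloc psi by exact: rintegrable_dloc.
pose f x := nu x * g x.
have fi : rintegrable setT f by exact: rintegrable_hsum.
have fl : dloc f by exact: rintegrable_dloc.
pose A := \int[mu]_x (g x ^+ 2 * nu x).
have eg : energy nu g = A%:E by rewrite energy_hsum.
have ef : energy u f = A%:E.
  rewrite -eg; apply: eq_integral => x _; congr EFin.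
  by rewrite /f /nu /inv_weight; field; rewrite gt_eqF.
have f2 : inL2 u f.
  apply: inL2_of_energy; first exact: rintegrable_measurable fi.
  by rewrite ef ltry.
pose c J := (-1) ^+ sg J * symbol w t J * haar_coef f J.
pose S := hsum c F.
have eS : (energy v S <= (2 * C ^+ 2 * A)%:E)%E.
  have := partial_sum_bound sg F f2 (rintegrable_locally fi).
  by rewrite (energy_tHaar_sum _ _ _ _ _ w0) ef -EFinM.
pose B := \int[mu]_x (S x ^+ 2 * v x).
have Bi : rintegrable setT (fun x => S x ^+ 2 * v x) by exact: rintegrable_hsum_sqr.
have {eS} BA : B <= 2 * C ^+ 2 * A by move: eS; rewrite energy_hsum // lee_fin.
have AE : A = \int[mu]_x (psi x * S x).
  transitivity (\int[mu]_x (f x * g x)).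
    by apply: eq_Rintegral => x _; rewrite /f; ring.
  rewrite !Rintegral_hsum //; apply: eq_bigr => J _.
  by rewrite /d /c -/psi; ring.
have k0 : 0 < 4 * C ^+ 2 by rewrite mulr_gt0 ?exprn_gt0.
(* Young's inequality with the weight that makes the first term at most A / 2 *)
have young : A <= (4 * C ^+ 2)^-1 * B + C ^+ 2 * dint v I.
  rewrite AE -Rintegral_indic -!RintegralZl // -RintegralD //; last 2 first.
  - exact: rintegrableZ.
  - exact: rintegrableZ.
  apply: le_Rintegral => //; first exact: rintegrable_hsum.
    by apply: rintegrableD => //; exact: rintegrableZ.
  move=> x _; rewrite /psi indicE; case: (x \in _) => /=; last first.
    rewrite !mulr0 mul0r addr0 mulr_ge0 ?invr_ge0 ?(ltW k0) //.
    by rewrite mulr_ge0 ?sqr_ge0 // ltW.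
  rewrite !mulr1 -subr_ge0.
  have -> : (4 * C ^+ 2)^-1 * (S x ^+ 2 * v x) + C ^+ 2 * v x - v x * S x =
      v x * (S x / (2 * C) - C) ^+ 2 by field; rewrite gt_eqF.
  by rewrite mulr_ge0 ?sqr_ge0 // ltW.
rewrite eg lee_fin.
have : (4 * C ^+ 2)^-1 * B <= 2^-1 * A.
  by rewrite mulrC ler_pdivrMr // (le_trans BA) // le_eqVlt; apply/orP; left;
    apply/eqP; field.
lra.
Qed.

Lemma dual_carleson_bound_of_bounded : dloc nu -> dloc v ->
  carleson_bound v nu w t (8 * C ^+ 2).
Proof.
move=> nul vl; apply/(carleson_boundP _ _ _ vl nul nu0) => I F FI.
pose psi x := v x * \1_(ditv I) x.
have [sg hsg] := exists_signs (fun J => symbol w t J * haar_coef psi J) nu0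
  mes_nu (fset_uniq F).
have := le_trans hsg (dual_haar_energy_le sg I F nul vl).
have -> : (\sum_(J <- F) ((symbol w t J * haar_coef psi J) ^+ 2)%:E * avg nu J)%E =
    (4^-1 * \sum_(J <- F)
      carleson_term (dint v) (dint nu) (density_symbol w t) J)%:E.
  rewrite mulr_sumr -sumEFin !big_seq; apply: eq_bigr => J /FI JI.
  rewrite avg_dint // -EFinM haar_coef_indic //; congr EFin.
  exact: haar_square_carleson.
by rewrite lee_fin; lra.
Qed.

End lower_bound.

(** * The theorem for positive weights *)

Section positive_weights.
Context {R : realType}.
Local Notation mu := (@lebesgue_measure R).

Lemma tHaar_bounded_by_le (u w : R -> R) t s (C C' : R) : C <= C' ->
  tHaar_bounded_by u w t s C -> tHaar_bounded_by u w t s C'.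
Proof.
move=> CC' H f f2 fl; have [g im le] := H f f2 fl; exists g => //.
by apply: le_trans le _; rewrite lee_wpmul2r ?lee_fin // sqrte_ge0.
Qed.

(** The conditions are non-strict inequalities between finite quantities, so they
    pass to the infimum of the admissible constants. *)
Lemma carleson_const_attained (nu v w : R -> R) t : dloc nu -> dloc v ->
  (forall x, 0 < nu x) -> (forall x, 0 < v x) ->
  (exists2 C : R, 0 < C & carleson_bound nu v w t C) ->
  exists c : R, [/\ 0 <= c, carleson_const nu v w t = c%:E &
    carleson_bound nu v w t c].
Proof.
move=> nul vl nu0 v0 [C C0 CC].
have inf0 : (0 <= carleson_const nu v w t)%E.
  by apply: le_ereal_inf_tmp => _ [D [D0 _] <-]; rewrite lee_fin ltW.
have fin : carleson_const nu v w t \is a fin_num.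
  rewrite ge0_fin_numE //; apply: (@le_lt_trans _ _ C%:E); last exact: ltry.
  by apply: ereal_inf_lbound; exists C.
exists (fine (carleson_const nu v w t)); split; rewrite ?fineK ?fine_ge0 //.
apply/(carleson_boundP _ _ _ nul vl v0) => I F FI.
have m0 := dint_gt0 I nul nu0.
rewrite -ler_pdivrMr // -lee_fin fineK //.
apply: le_ereal_inf_tmp => _ [D [D0 /(carleson_boundP _ _ _ nul vl v0) DD] <-].
by rewrite lee_fin ler_pdivrMr // DD.
Qed.

Variables (u w : R -> R) (t : R).
Hypotheses (mes_u : measurable_fun setT u) (mes_w : measurable_fun setT w).
Hypotheses (u0 : forall x, 0 < u x) (w0 : forall x, 0 < w x).
Hypotheses (ul : dloc u) (wl : dloc w) (ht : t <= 0 \/ 1 <= t).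
Let nu := inv_weight u.
Let v := mul_weight u w t.
Let conditions := [/\ (joint_const u w t < +oo)%E,
  exists2 C : R, 0 < C & carleson_bound nu v w t C &
  exists2 C : R, 0 < C & carleson_bound v nu w t C].

Let nu0 x : 0 < nu x. Proof. by rewrite invr_gt0. Qed.
Let v0 x : 0 < v x. Proof. by rewrite mulr_gt0 // powR_gt0. Qed.

Lemma conditions_of_bounded : tHaar_unif_bounded u w t -> conditions.
Proof.
move=> [C C0 CC].
have C1 : 0 < C + 1 by rewrite ltr_wpDl.
have bnd s : tHaar_bounded_by u w t s (C + 1).
  by apply: tHaar_bounded_by_le (CC s); rewrite lerDl.
have jl := joint_const_le mes_u mes_w u0 w0 wl C1 bnd.
have joint : (joint_const u w t < +oo)%E by apply: le_lt_trans jl (ltry _).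
have [nul vl] := dloc_of_joint mes_u mes_w u0 w0 wl joint.
have p0 : 0 < 8 * (C + 1) ^+ 2 by rewrite mulr_gt0 ?exprn_gt0.
split=> //; exists (8 * (C + 1) ^+ 2) => //.
- exact: carleson_bound_of_bounded.
- exact: dual_carleson_bound_of_bounded.
Qed.

(** The optimal constants satisfy the conditions themselves, so S bounds every
    multiplier without a further constant. *)
Lemma conditions_constants : conditions -> exists c1 c2 c3 : R,
  [/\ [/\ joint_const u w t = c1%:E, carleson_const nu v w t = c2%:E &
      carleson_const v nu w t = c3%:E], dloc nu /\ dloc v &
   forall s, tHaar_bounded_by u w t s
     (Num.sqrt c1 + Num.sqrt c2 + Num.sqrt c3 + Num.sqrt (c2 * c3))].
Proof.
move=> [joint H2 H3].
have [nul vl] := dloc_of_joint mes_u mes_w u0 w0 wl joint.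
have [c2 [c20 c2E c2P]] := carleson_const_attained nul vl nu0 v0 H2.
have [c3 [c30 c3E c3P]] := carleson_const_attained vl nul v0 nu0 H3.
have le I : ((density_symbol w t I ^+ 2 * dint nu I * dint v I)%:E
    <= joint_const u w t)%E.
  by rewrite -(joint_termE _ nul vl); apply: ereal_sup_ubound; exists I.
have fin : joint_const u w t \is a fin_num.
  rewrite ge0_fin_numE //; apply: le_trans (le (0, 0)); rewrite lee_fin.
  rewrite mulr_ge0 ?(ltW (dint_gt0 _ vl v0)) // mulr_ge0 ?sqr_ge0 //.
  exact/ltW/dint_gt0.
exists (fine (joint_const u w t)), c2, c3; split => //; first by split; rewrite ?fineK.
move=> s f [mf fl2] fl.
have jle I : density_symbol w t I ^+ 2 * dint nu I * dint v I
    <= fine (joint_const u w t) by rewrite -lee_fin fineK.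
apply: (tHaar_image_exists mes_u mes_w u0 w0 ht wl nul vl jle c20 c30 c2P c3P mf) => //.
  exact: locally_integrable_dloc.
move: fl2; rewrite L2norm_energy -ge0_fin_numE ?sqrte_ge0 //.
by rewrite sqrte_fin_num ?energy_ge0 // ge0_fin_numE ?energy_ge0.
Qed.

Lemma bounded_of_conditions : conditions -> tHaar_unif_bounded u w t.
Proof.
move=> /conditions_constants [c1 [c2 [c3 [_ _ bnd]]]].
exists (Num.sqrt c1 + Num.sqrt c2 + Num.sqrt c3 + Num.sqrt (c2 * c3)) => //.
Qed.

Lemma norm_equivalence : tHaar_unif_bounded u w t ->
  let C1 := joint_const u w t in
  let C2 := carleson_const nu v w t in
  let C3 := carleson_const v nu w t in
  let S := (sqrte C1 + sqrte C2 + sqrte C3 + sqrte (C2 * C3))%E in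
  [/\ forall s : dyadic -> bool, (tHaar_norm u w t s <= 8%:E * S)%E,
      exists2 c : R, 0 < c &
        forall s : dyadic -> bool, (S <= c%:E * tHaar_norm u w t s)%E
    & (sqrte C1 + sqrte C2 + sqrte C3
         <= 8%:E * ereal_sup (range (tHaar_norm u w t)))%E].
Proof.
move=> bounded; have cond := conditions_of_bounded bounded.
have [c1 [c2 [c3 [[c1E c2E c3E] [nul vl] bnd]]]] := conditions_constants cond.
rewrite /= c1E c2E c3E /= -!EFinD.
set S := _ + Num.sqrt (c2 * c3).
have S0 : 0 <= S by rewrite !addr_ge0 ?sqrtr_ge0.
have [del del0 delP] := tHaar_norm_gt0 mes_u mes_w u0 w0 wl ul vl.
split.
- move=> s; apply: (@le_trans _ _ S%:E).
    by apply: ereal_inf_lbound; exists S.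
  by rewrite -EFinM lee_fin ler_peMl // ler1n.
- exists (S / del + 1); first by rewrite ltr_wpDl // divr_ge0 // ltW.
  move=> s.
  have c0 : 0 <= S / del + 1 by rewrite addr_ge0 // divr_ge0 // ltW.
  apply: (@le_trans _ _ ((S / del + 1)%:E * del%:E)%E).
    by rewrite -EFinM lee_fin mulrDl mul1r mulfVK ?gt_eqF // lerDl ltW.
  rewrite lee_wpmul2l ?lee_fin //; apply: le_ereal_inf_tmp => _ [C [C0 CP] <-].
  by rewrite lee_fin; exact: (delP s).
have norm0 s : (0 <= tHaar_norm u w t s)%E.
  by apply: le_ereal_inf_tmp => _ [C [C0 _] <-]; rewrite lee_fin.
set N := ereal_sup _.
have leN s : (tHaar_norm u w t s <= N)%E by apply: ereal_sup_ubound; exists s.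
have N0 : (0 <= N)%E by apply: le_trans (leN (fun=> false)).
have finN : N \is a fin_num.
  rewrite ge0_fin_numE //; apply: (@le_lt_trans _ _ S%:E); last exact: ltry.
  by apply: ge_ereal_sup => _ [s _ <-]; apply: ereal_inf_lbound; exists S.
rewrite -(fineK finN) -EFinM lee_fin.
have r0 : 0 <= fine N by rewrite fine_ge0.
move: leN; rewrite -(fineK finN); move: (fine N) r0 => r r0 leN.
apply/ler_addgt0Pr => e e0.
pose q := r + e / 8.
have q0 : 0 < q by rewrite ltr_wpDl // divr_gt0.
have bq s : tHaar_bounded_by u w t s q.
  have : (tHaar_norm u w t s < q%:E)%E.
    by apply: le_lt_trans (leN s) _; rewrite lte_fin ltrDl divr_gt0.
  by move=> /ereal_inf_lt [_ [C [_ CP] <-]]; rewrite lte_fin => /ltW /tHaar_bounded_by_le; apply.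
(* the squares of the constants are 2, 8 and 8, whose roots sum to at most 8 *)
have h1 : Num.sqrt c1 <= 2 * q.
  have := joint_const_le mes_u mes_w u0 w0 wl q0 bq; rewrite c1E lee_fin => le.
  rewrite -[leRHS]ger0_norm ?mulr_ge0 ?(ltW q0) // -sqrtr_sqr ler_wsqrtr //.
  by apply: (le_trans le); rewrite exprMn ler_wpM2r ?sqr_ge0 //; lra.
have p0 : 0 < 8 * q ^+ 2 by rewrite mulr_gt0 ?exprn_gt0.
have sqrt8 c : c <= 8 * q ^+ 2 -> Num.sqrt c <= 3 * q.
  move=> le; rewrite -[leRHS]ger0_norm ?mulr_ge0 ?(ltW q0) // -sqrtr_sqr ler_wsqrtr //.
  by apply: (le_trans le); rewrite exprMn ler_wpM2r ?sqr_ge0 //; lra.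
have h2 : Num.sqrt c2 <= 3 * q.
  apply: sqrt8; rewrite -lee_fin -c2E; apply: ereal_inf_lbound.
  exists (8 * q ^+ 2) => //; split => //; exact: carleson_bound_of_bounded.
have h3 : Num.sqrt c3 <= 3 * q.
  apply: sqrt8; rewrite -lee_fin -c3E; apply: ereal_inf_lbound.
  exists (8 * q ^+ 2) => //; split => //; exact: dual_carleson_bound_of_bounded.
by rewrite /=; move: h1 h2 h3; rewrite /q; lra.
Qed.

End positive_weights.

(** * Passing to everywhere positive representatives *)

Section representatives.
Context {R : realType}.
Local Notation mu := (@lebesgue_measure R).
Implicit Types (f g u w : R -> R) (I : dyadic).

(** The value 1 is arbitrary: for a weight it replaces u on a null set only. *)
Definition positive_version u x := if 0 < u x then u x else 1.

Lemma positive_version_gt0 u x : 0 < positive_version u x.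
Proof. by rewrite /positive_version; case: ifP. Qed.

Lemma measurable_positive_version u : measurable_fun setT u ->
  measurable_fun setT (positive_version u).
Proof.
move=> mf; apply: measurable_fun_ifT => //.
by apply: measurable_fun_ltr.
Qed.

Lemma dloc_positive_version u : measurable_fun setT u -> dloc u ->
  dloc (positive_version u).
Proof.
move=> mes_u ul I; have mI := @measurable_ditv R I.
have ui : rintegrable (ditv I) (fun x => `|u x| + 1).
  by apply: rintegrableD => //; [exact: integrable_norm (ul I)|exact: dloc_cst].
apply: (rintegrable_le mI _ _ ui).
  by apply: measurable_funTS; exact: measurable_positive_version.
move=> x _; rewrite /positive_version; case: ifP => _.
  by rewrite lerDl.
by rewrite normr1 lerDr.
Qed.

Definition ae_equal f g := {ae mu, forall x, f x = g x}.

Lemma ae_imply2 (P Q S : R -> Prop) : (forall x, P x -> Q x -> S x) ->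
  {ae mu, forall x, P x} -> {ae mu, forall x, Q x} -> {ae mu, forall x, S x}.
Proof.
move=> PQS aP aQ; have := negligibleU aP aQ; apply: negligibleS => x /= nS.
have [Px|nP] := pselect (P x); last by left.
by right => Qx; apply/nS/PQS.
Qed.

Lemma ae_positive_version u : {ae mu, forall x, 0 < u x} ->
  ae_equal u (positive_version u).
Proof.
by move=> h; apply: (ae_imply2 _ h h) => x ux _; rewrite /positive_version ux.
Qed.

Lemma ae_equal_sym f g : ae_equal f g -> ae_equal g f.
Proof. by move=> h; apply: (ae_imply2 _ h h) => x ->. Qed.

Lemma ae_equal_measurable_integral (f g : R -> R) D : measurable (D : set (measurableTypeR R)) ->
  measurable_fun setT f -> measurable_fun setT g -> ae_equal f g ->
  (\int[mu]_(x in D) (f x)%:E = \int[mu]_(x in D) (g x)%:E)%E.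
Proof.
move=> mD mf mg fg; apply: ae_eq_integral => //.
- by apply/measurable_EFinP; exact: measurable_funTS.
- by apply/measurable_EFinP; exact: measurable_funTS.
by apply: (ae_imply2 _ fg fg) => x -> _ _.
Qed.

Lemma avg_ae f g : measurable_fun setT f -> measurable_fun setT g ->
  ae_equal f g -> avg f = avg g.
Proof.
move=> mf mg fg; apply/funext => I; rewrite /avg; congr (_ * _)%E.
by apply: ae_equal_measurable_integral => //; exact: measurable_ditv.
Qed.

Lemma L2norm_ae u1 u2 f g : measurable_fun setT u1 -> measurable_fun setT u2 ->
  measurable_fun setT f -> measurable_fun setT g ->
  ae_equal u1 u2 -> ae_equal f g -> L2norm u1 f = L2norm u2 g.
Proof.
move=> mu1 mu2 mf mg u12 fg; rewrite !L2norm_energy; congr sqrte.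
apply: ae_equal_measurable_integral => //.
- by apply: measurable_funM => //; exact: measurable_funX.
- by apply: measurable_funM => //; exact: measurable_funX.
by apply: (ae_imply2 _ u12 fg) => x -> ->.
Qed.

Lemma tHaar_sum_ae w1 w2 t s f F : avg w1 = avg w2 -> ae_equal w1 w2 ->
  ae_equal (tHaar_sum w1 t s f F) (tHaar_sum w2 t s f F).
Proof.
by move=> a12 w12; apply: (ae_imply2 _ w12 w12) => x e _; rewrite /tHaar_sum a12 e.
Qed.

Lemma tHaar_bounded_by_ae u1 u2 w1 w2 t s C :
  measurable_fun setT u1 -> measurable_fun setT u2 ->
  measurable_fun setT w1 -> measurable_fun setT w2 ->
  ae_equal u1 u2 -> ae_equal w1 w2 ->
  tHaar_bounded_by u1 w1 t s C -> tHaar_bounded_by u2 w2 t s C.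
Proof.
move=> mu1 mu2 mw1 mw2 u12 w12 H f [mf f2] fl.
have refl g : ae_equal g g by apply: (ae_imply2 _ u12 u12).
have LE g : measurable_fun setT g -> L2norm u2 g = L2norm u1 g.
  by move=> mg; apply: L2norm_ae => //; exact: ae_equal_sym.
have [|g [[mg g2] gcv] gle] := H f _ fl; first by split=> //; rewrite -LE.
exists g; last by rewrite !LE.
split; first by split => //; rewrite LE.
have -> : (fun F => L2norm u2 (fun x => tHaar_sum w2 t s f F x - g x)) =
    (fun F : {fset dyadic} => L2norm u1 (fun x => tHaar_sum w1 t s f F x - g x)).
  apply/funext => F; apply: (L2norm_ae mu2 mu1 _ _ (ae_equal_sym u12)).
  - by apply: measurable_funB => //; exact: measurable_tHaar_sum.
  - by apply: measurable_funB => //; exact: measurable_tHaar_sum.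
  have sw := ae_equal_sym (tHaar_sum_ae t s f F (avg_ae mw1 mw2 w12) w12).
  by apply: (ae_imply2 _ sw sw) => x -> _.
exact: gcv.
Qed.

End representatives.

Theorem theorem2 (R : realType) :
  exists2 K : R, 0 < K &
  forall (u w : R -> R) (t : R), weight u -> weight w -> t <= 0 \/ 1 <= t ->
    let iu := inv_weight u in
    let v := mul_weight u w t in
    let C1 := joint_const u w t in
    let C2 := carleson_const iu v w t in
    let C3 := carleson_const v iu w t in
    (tHaar_unif_bounded u w t <->
       [/\ (C1 < +oo)%E,
           exists2 C : R, 0 < C & carleson_bound iu v w t C
         & exists2 C : R, 0 < C & carleson_bound v iu w t C]) /\
    (tHaar_unif_bounded u w t ->
       let S := (sqrte C1 + sqrte C2 + sqrte C3 + sqrte (C2 * C3))%E in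
       [/\ forall s : dyadic -> bool, (tHaar_norm u w t s <= K%:E * S)%E,
           exists2 c : R, 0 < c &
             forall s : dyadic -> bool, (S <= c%:E * tHaar_norm u w t s)%E
         & (sqrte C1 + sqrte C2 + sqrte C3
              <= K%:E * ereal_sup (range (tHaar_norm u w t)))%E]).
Proof.
exists 8 => // u w t [uloc upos] [wloc wpos] ht.
have mes_u : measurable_fun setT u by case: uloc.
have mes_w : measurable_fun setT w by case: wloc.
have ul := dloc_positive_version mes_u (locally_integrable_dloc uloc).
have wl := dloc_positive_version mes_w (locally_integrable_dloc wloc).
have ueq := ae_positive_version upos; have weq := ae_positive_version wpos.
have u0 := positive_version_gt0 u; have w0 := positive_version_gt0 w.
have mu' := measurable_positive_version mes_u.
have mw' := measurable_positive_version mes_w.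
move: (positive_version u) (positive_version w) ul wl ueq weq u0 w0 mu' mw'.
move=> u' w' ul wl ueq weq u0 w0 mu' mw'.
have wE : avg w = avg w' by exact: avg_ae.
have iE : avg (inv_weight u) = avg (inv_weight u').
  apply: avg_ae; try exact: measurable_inv_weight.
  by apply: (ae_imply2 _ ueq ueq) => x e _; rewrite /inv_weight e.
have vE : avg (mul_weight u w t) = avg (mul_weight u' w' t).
  apply: avg_ae; try exact: measurable_mul_weight.
  by apply: (ae_imply2 _ ueq weq) => x e1 e2; rewrite /mul_weight e1 e2.
have C1E : joint_const u w t = joint_const u' w' t.
  by rewrite /joint_const iE vE wE.
have b2E : carleson_bound (inv_weight u) (mul_weight u w t) w t =
    carleson_bound (inv_weight u') (mul_weight u' w' t) w' t.
  by apply/funext => C; rewrite /carleson_bound /delta iE vE wE.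
have b3E : carleson_bound (mul_weight u w t) (inv_weight u) w t =
    carleson_bound (mul_weight u' w' t) (inv_weight u') w' t.
  by apply/funext => C; rewrite /carleson_bound /delta iE vE wE.
have bE s : tHaar_bounded_by u w t s = tHaar_bounded_by u' w' t s.
  apply/funext => C; apply/propext; split.
    exact: (tHaar_bounded_by_ae mes_u mu' mes_w mw' ueq weq).
  exact: (tHaar_bounded_by_ae mu' mes_u mw' mes_w (ae_equal_sym ueq) (ae_equal_sym weq)).
have nE : tHaar_norm u w t = tHaar_norm u' w' t.
  by apply/funext => s; rewrite /tHaar_norm bE.
have uE : tHaar_unif_bounded u w t = tHaar_unif_bounded u' w' t.
  apply/propext; split=> -[C C0 CP]; (exists C; first exact: C0) => s.
    by rewrite -bE; exact: CP.
  by rewrite bE; exact: CP.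
rewrite /carleson_const b2E b3E C1E nE uE; split; [split|].
- exact: conditions_of_bounded.
- exact: bounded_of_conditions.
- exact: norm_equivalence.
Qed.
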